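(* Let $m,n\ge 1$, let $A_1,\dots,A_m$ be normal $n\times n$ complex matrices, let $Z_1,\dots,Z_m$ be expansive $n\times n$ complex matrices (that is, $Z_i^*Z_i\ge I$ for each $i$), and let $f:[0,\infty)\to[0,\infty)$ be concave and e-convex. Then, for every symmetric norm $\|\cdot\|$ on the $n\times n$ complex matrices, $$ \left\|f\left(\left|\sum_{i=1}^m Z_i^*A_iZ_i\right|\right)\right\|\le\left\|\sum_{i=1}^m Z_i^*f(|A_i|)Z_i\right\|. $$
   Context: For a complex matrix $X$, $|X|=(X^*X)^{1/2}$. For a positive semi-definite $P$, $f(P)$ is defined by the functional calculus. The order $\ge$ is the usual (Loewner) order on Hermitian matrices, and $I$ is the identity. A function $f$ on $[0,\infty)$ is called e-convex if $t\mapsto f(e^t)$ is convex on $(-\infty,\infty)$. A symmetric (or unitarily invariant) norm is a norm on complex matrices satisfying $\|X\|=\|UXV\|$ for all $X$ and all unitaries $U,V$. *)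

(* Defs.v *)
From HB Require Import structures.
From mathcomp Require Import all_boot all_order all_algebra.
From mathcomp Require Import complex.
From mathcomp Require Import all_classical all_reals all_analysis.

Set Implicit Arguments.
Unset Strict Implicit.
Unset Printing Implicit Defensive.

Import Order.TTheory GRing.Theory Num.Theory.
Local Open Scope ring_scope.
Local Open Scope sesquilinear_scope.
Local Open Scope complex_scope.
Local Open Scope classical_set_scope.

(* Functional calculus g(P) = U^* diag(g(lambda_1), ..., g(lambda_n)) U for a
   Hermitian matrix P = U^* diag(lambda_1, ..., lambda_n) U, U unitary; the
   eigenvalues lambda_i are real, so taking real parts loses nothing.  The value
   is meaningless when P is not Hermitian. *)
Definition mxfun (R : realType) (n : nat) (g : R -> R) (P : 'M[R[i]]_n) :
    'M[R[i]]_n :=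
  (spectralmx P)^t*
    *m diag_mx (map_mx (fun z => (g (complex.Re z))%:C) (spectral_diag P))
    *m spectralmx P.

Definition mxabs (R : realType) (n : nat) (X : 'M[R[i]]_n) : 'M[R[i]]_n :=
  mxfun Num.sqrt (X^t* *m X).

(* In R[i], 0 <= z means that z is real and nonnegative. *)
Definition psdmx (R : realType) (n : nat) (A : 'M[R[i]]_n) : Prop :=
  A \is hermsymmx /\ forall v : 'cV[R[i]]_n, 0 <= (v^t* *m A *m v) 0 0.

Definition loewner_le (R : realType) (n : nat) (A B : 'M[R[i]]_n) : Prop :=
  psdmx (B - A).

Definition expansive (R : realType) (n : nat) (Z : 'M[R[i]]_n) : Prop :=
  loewner_le 1%:M (Z^t* *m Z).

Definition concave_on_nonneg (R : realType) (f : R -> R) : Prop :=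
  convex_function (`[0, +oo[ : set R^o) (fun t : R^o => - f t).

Definition e_convex (R : realType) (f : R -> R) : Prop :=
  convex_function (setT : set R^o) (fun t : R^o => f (expR t)).

Record symmetric_norm (R : realType) (n : nat) (N : 'M[R[i]]_n -> R) : Prop :=
  SymmetricNorm {
    snorm_ge0 : forall X, 0 <= N X;
    snorm_eq0 : forall X, N X = 0 -> X = 0;
    snormD : forall X Y, N (X + Y) <= N X + N Y;
    snormZ : forall (a : R[i]) X, N (a *: X) = complex.Re `|a| * N X;
    snorm_unitary : forall U V X, U \is unitarymx -> V \is unitarymx ->
      N (U *m X *m V) = N X
  }.

(* Main.v *)
(** Write [S = \sum Z_i^* A_i Z_i], [T = \sum Z_i^* |A_i| Z_i] and
    [B = \sum Z_i^* f(|A_i|) Z_i], and let [s] and [lam] be the decreasing lists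
    of singular values of [S] and eigenvalues of [T].

    Since the [A_i] are normal, [2 Re <x, S y> <= <x, T x> + <y, T y>].  This
    makes [S] a contraction relative to [T], so every initial product of [s] is
    at most that of [lam]; as [f \o exp] is convex and nondecreasing, the initial
    sums satisfy [\sum_(j < k) f (s j) <= \sum_(j < k) f (lam j)].

    Diagonalizing the [A_i], [T = \sum_r p_r z_r z_r^*] and
    [B = \sum_r f(p_r) z_r z_r^*] with [|z_r| >= 1].  For a convex [g >= 0] with
    [g 0 = 0], [\sum_r g(p_r) |z_r|^2 <= Tr g(T)].  Writing
    [f(t) >= f 0 + b t - g(t)], with [b] and such a [g] adapted to the [k]
    largest eigenvalues of [T], where equality holds, shows that
    [\sum_(j < k) f (lam j)] is at most the sum of the first [k] diagonal
    entries of [B] in an eigenbasis of [T].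

    Thus [f \o s] is weakly majorized by the diagonal of [B] in that basis, and
    pinching to the diagonal decreases every symmetric norm. *)
Require Import Defs.
From HB Require Import structures.
From mathcomp Require Import all_boot all_order all_algebra all_fingroup.
From mathcomp Require Import complex.
From mathcomp Require Import all_classical all_reals all_analysis.
From mathcomp Require Import ring lra.

Set Implicit Arguments.
Unset Strict Implicit.
Unset Printing Implicit Defensive.

Import Order.TTheory GRing.Theory Num.Theory.
Local Open Scope ring_scope.
Local Open Scope sesquilinear_scope.
Local Open Scope complex_scope.

(** * Convexity on the real line *)

Section RealConvexity.
Variable R : realType.
Implicit Types (f g : R -> R) (D : R -> Prop).

(** The chord inequality multiplied by [y - x], so that no division occurs. *)
Definition convex_on D g := forall x a y, D x -> D y -> x < a -> a < y ->
  g a * (y - x) <= g x * (y - a) + g y * (a - x).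

(** The slope is the supremum of the difference quotients to the left of [a]. Each quotient to the
    right bounds them, and [x0], [y0] make both families nonempty. *)
Lemma convex_on_subgradient D g a x0 y0 : convex_on D g ->
  D x0 -> x0 < a -> D y0 -> a < y0 ->
  exists c, forall x, D x -> g a + c * (x - a) <= g x.
Proof.
move=> cvx Dx0 x0a Dy0 ay0.
pose S : set R := fun s => exists x, [/\ D x, x < a & s = (g a - g x) / (a - x)].
have ubS y : D y -> a < y -> ubound S ((g y - g a) / (y - a)).
  move=> Dy ay _ [x [Dx xa ->]].
  rewrite ler_pdivrMr ?subr_gt0// mulrAC ler_pdivlMr ?subr_gt0//.
  have := cvx x a y Dx Dy xa ay; lra.
have supS : has_sup S.
  split; first by exists ((g a - g x0) / (a - x0)); exists x0.
  by exists ((g y0 - g a) / (y0 - a)); apply: ubS.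
exists (sup S) => x Dx.
have [xa|ax|->] := ltgtP x a; last by rewrite subrr mulr0 addr0.
- have : (g a - g x) / (a - x) <= sup S.
    by apply: ub_le_sup; [case: supS | exists x].
  by rewrite ler_pdivrMr ?subr_gt0// => ?; lra.
- have : sup S <= (g x - g a) / (x - a).
    by apply: ge_sup; [case: supS | apply: ubS].
  by rewrite ler_pdivlMr ?subr_gt0// => ?; lra.
Qed.

Lemma convex_function_on (D : set R^o) (f : R^o -> R^o) :
  convex_function D f -> convex_on (fun t => t \in D) f.
Proof.
move=> cvf x a y Dx Dy xa ay.
have yx0 : 0 < y - x by rewrite subr_gt0 (lt_trans xa).
(* This is the weight of [x] in the convex combination of [x] and [y] equal to [a]. *)
have t0 : 0 <= (y - a) / (y - x) by rewrite divr_ge0 ?subr_ge0 ?ltW// (lt_trans xa).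
have t1 : (y - a) / (y - x) <= 1 by rewrite ler_pdivrMr// mul1r; lra.
have := cvf (Itv01 t0 t1) x y Dx Dy.
rewrite [X in f X <= _](_ : _ = a); last first.
  change ((y - a) / (y - x) * x + (1 - (y - a) / (y - x)) * y = a).
  by field; rewrite gt_eqF.
rewrite convRE /= /unstable.onem => H.
rewrite -ler_pdivlMr//; apply: (le_trans H).
by rewrite le_eqVlt; apply/orP; left; apply/eqP; field; rewrite gt_eqF.
Qed.

Lemma concave_on_nonneg_cvx f : concave_on_nonneg f ->
  convex_on (fun t => 0 <= t) (fun t => - f t).
Proof.
move=> /convex_function_on cvf x a y x0 y0.
by apply: cvf; rewrite inE/= in_itv/= ?x0 ?y0.
Qed.

Lemma e_convex_cvx f : e_convex f -> convex_on (fun=> True) (f \o expR).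
Proof.
by move=> /convex_function_on cvf x a y _ _; apply: cvf; rewrite inE.
Qed.

Section NonnegConcave.
Variable f : R -> R.
Hypothesis f_ge0 : forall t, 0 <= t -> 0 <= f t.
Hypothesis f_cvx : convex_on (fun t => 0 <= t) (fun t => - f t).

(* If [f] decreased somewhere, concavity would drive it below 0. *)
Lemma nonneg_concave_mono a b : 0 <= a -> a <= b -> f a <= f b.
Proof.
move=> a0; rewrite le_eqVlt => /predU1P[->//|ab].
rewrite leNgt; apply/negP => fba.
have d0 : 0 < f a - f b by rewrite subr_gt0.
(* The line through [(a, f a)] and [(b, f b)] takes the value [f b - f a - 1 < 0] at [y], and
   concavity keeps [f y] below it. *)
pose y := b + (f a + 1) / (f a - f b) * (b - a).
have fa0 := f_ge0 a0.
have by_ : b < y by rewrite ltrDl mulr_gt0 ?subr_gt0// divr_gt0 ?subr_gt0//; lra.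
have y0 : 0 <= y by lra.
have := f_cvx a0 y0 ab by_.
have : (y - b) * (f a - f b) = (f a + 1) * (b - a).
  by rewrite /y; field; rewrite gt_eqF.
have := f_ge0 y0.
set z := y - b; move=> fy0 ez.
have -> : y - a = z + (b - a) by rewrite /z; ring.
have fb0 : 0 <= f b by apply: f_ge0; lra.
have ba0 : 0 < b - a by lra.
have := mulr_ge0 fy0 (ltW ba0); have := mulr_ge0 fb0 (ltW ba0);
  have := mulr_ge0 fa0 (ltW ba0).
nra.
Qed.

Lemma concave_slope s t : 0 < s -> s <= t ->
  (f t - f 0) * s <= (f s - f 0) * t.
Proof.
move=> s0; rewrite le_eqVlt => /predU1P[->//|st].
have := f_cvx (lexx 0) (ltW (lt_trans s0 st)) s0 st; lra.
Qed.

End NonnegConcave.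

End RealConvexity.

(** * Trace inequality and concave functions *)

Section SquaredModulus.
Variable R : realType.
Implicit Types (z w : R[i]) (a : R).

(** Squared modulus valued in [R], so that sums and comparisons stay real. *)
Definition sqn z : R := complex.Re z ^+ 2 + complex.Im z ^+ 2.

Lemma sqn_ge0 z : 0 <= sqn z. Proof. by rewrite addr_ge0 ?sqr_ge0. Qed.

Lemma sqnE z : (sqn z)%:C = Num.conj z * z.
Proof. by rewrite /sqn add_Re2_Im2 normCKC. Qed.

Lemma sqnM z w : sqn (z * w) = sqn z * sqn w.
Proof. by case: z w => [a b] [c d]; rewrite /sqn /=; ring. Qed.

Lemma realcD a b : (a + b)%:C = a%:C + b%:C. Proof. exact: rmorphD. Qed.

Lemma realcM a b : (a * b)%:C = a%:C * b%:C. Proof. exact: rmorphM. Qed.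

Lemma conj_mul z w : Num.conj (z * w) = Num.conj z * Num.conj w.
Proof. exact: rmorphM. Qed.

Lemma conj_realc a : Num.conj (a%:C) = a%:C. Proof. exact: conjc_real. Qed.

Lemma sqn_realc a : sqn a%:C = a ^+ 2.
Proof. by rewrite /sqn /= expr0n addr0. Qed.

Lemma sqn_eq0 z : sqn z = 0 -> z = 0.
Proof.
case: z => a b /eqP; rewrite /sqn /= paddr_eq0 ?sqr_ge0// !sqrf_eq0.
by case/andP => /eqP -> /eqP ->.
Qed.

Lemma sum_complex (I : finType) (P : pred I) (F : I -> R) :
  (\sum_(i | P i) F i)%:C = \sum_(i | P i) (F i)%:C.
Proof. exact: rmorph_sum. Qed.

(** The columns selected by [e] are orthonormal and the others vanish, so the Gram matrix of the
    rows is an orthogonal projection. Its row [r] is [u], up to conjugation, and its diagonal entry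
    [t] satisfies [t ^+ 2 <= t]. *)
Lemma bessel (I J : finType) (x : I -> J -> R[i]) (e : pred J) :
  (forall j j', \sum_r Num.conj (x r j) * x r j' = ((j == j') && e j)%:R) ->
  forall r, \sum_j sqn (x r j) <= 1.
Proof.
move=> xo r; set t := \sum_j _.
pose u s := \sum_j Num.conj (x r j) * x s j.
have ur : u r = t%:C.
  by rewrite sum_complex; apply: eq_bigr => j _; rewrite sqnE.
have su : \sum_s sqn (u s) = \sum_j (e j)%:R * sqn (x r j).
  apply: complexI; rewrite !sum_complex.
  under eq_bigr => s _.
    rewrite sqnE /u rmorph_sum big_distrlr /=.
    over.
  rewrite exchange_big /=; apply: eq_bigr => j _.
  rewrite exchange_big /= (bigD1 j) //= [X in _ + X]big1 ?addr0.
    rewrite realcM sqnE.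
    transitivity ((x r j * Num.conj (x r j)) *
      \sum_s Num.conj (x s j) * x s j).
      rewrite mulr_sumr; apply: eq_bigr => s _.
      by rewrite conj_mul conjCK mulrACA.
    by rewrite xo eqxx /= mulrC (mulrC (x r j)) rmorph_nat.
  move=> j' jj'.
  transitivity ((x r j * Num.conj (x r j')) *
      \sum_s Num.conj (x s j) * x s j').
    rewrite mulr_sumr; apply: eq_bigr => s _.
    by rewrite conj_mul conjCK mulrACA.
  by rewrite xo eq_sym (negbTE jj') mulr0.
have t0 : 0 <= t by apply: sumr_ge0 => j _; apply: sqn_ge0.
have tt : t ^+ 2 <= t.
  rewrite -sqn_realc -ur; apply: (@le_trans _ _ (\sum_s sqn (u s))).
    rewrite (bigD1 r) //= lerDl; apply: sumr_ge0 => s _; exact: sqn_ge0.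
  rewrite su; apply: ler_sum => j _.
  by case: (e j); rewrite ?mul1r// mul0r sqn_ge0.
have [->//|tn0] := eqVneq t 0.
have tp : 0 < t by rewrite lt_neqAle eq_sym tn0.
by rewrite -(ler_pM2r tp) mul1r -expr2.
Qed.

End SquaredModulus.

Section TraceInequality.
Variables (R : realType) (g : R -> R).
Hypothesis g_cvx : convex_on (fun t => 0 <= t) g.
Hypothesis g0 : g 0 = 0.
Hypothesis g_ge0 : forall t, 0 <= t -> 0 <= g t.

(** Jensen's inequality with the missing weight placed at 0, where [g] vanishes. *)
Lemma subconvex_jensen (J : finType) (d lam : J -> R) :
  (forall j, 0 <= d j) -> \sum_j d j <= 1 -> (forall j, 0 <= lam j) ->
  g (\sum_j d j * lam j) <= \sum_j d j * g (lam j).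
Proof.
move=> d0 d1 lam0; have [t tE] : exists t, \sum_j d j * lam j = t
  by exists (\sum_j d j * lam j).
rewrite tE; have : 0 <= t by rewrite -tE; apply: sumr_ge0 => j _; rewrite mulr_ge0.
(* A subgradient at [t] requires a point to its left, so [t = 0] is settled separately by
   [g >= 0]. *)
rewrite le_eqVlt => /predU1P[<-|t0].
  by rewrite g0 sumr_ge0// => j _; rewrite mulr_ge0// g_ge0.
have [c cP] : exists c, forall x, 0 <= x -> g t + c * (x - t) <= g x.
  have t1 : t < t + 1 by rewrite ltrDl.
  exact: (convex_on_subgradient g_cvx (lexx 0) t0 (ltW (lt_trans t0 t1)) t1).
apply: (@le_trans _ _ (\sum_j d j * (g t + c * (lam j - t)))); last first.
  by apply: ler_sum => j _; rewrite ler_wpM2l// cP.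
have -> : \sum_j d j * (g t + c * (lam j - t)) =
    (\sum_j d j) * (g t - c * t) + c * t.
  transitivity ((\sum_j d j) * (g t - c * t) + c * \sum_j d j * lam j);
    last by rewrite tE.
  rewrite mulr_suml mulr_sumr -big_split /=; apply: eq_bigr => j _; ring.
(* The subgradient inequality at 0 gives [g t - c * t <= 0], which absorbs a total weight below
   1. *)
have := cP 0 (lexx 0); rewrite g0; nra.
Qed.

(** Since [g 0 = 0], the slope [g t / t] of the chord from the origin is nondecreasing. *)
Lemma convex_scale_ge t w : 0 <= t -> 1 <= w -> g t * w <= g (t * w).
Proof.
move=> + w1; rewrite le_eqVlt => /predU1P[<-|t0]; first by rewrite !mul0r g0 mul0r.
move: w1; rewrite le_eqVlt => /predU1P[<-|w1]; first by rewrite !mulr1.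
have tw : t < t * w by rewrite ltr_pMr.
have := g_cvx (lexx 0) (ltW (lt_trans t0 tw)) t0 tw.
rewrite g0 mul0r add0r !subr0 => h.
by rewrite -(ler_pM2r t0) mulrAC -mulrA.
Qed.

(* With [y r j] the coordinates of vectors [z_r] in an eigenbasis of
   [T = \sum_r p_r z_r z_r^*], this is
   [\sum_r g(p_r) |z_r|^2 <= Tr g(T)] as soon as all [|z_r| >= 1]. *)
Lemma trace_convex_ge (I J : finType) (y : I -> J -> R[i]) (p : I -> R)
    (lam : J -> R) :
  (forall r, 0 <= p r) -> (forall j, 0 <= lam j) ->
  (forall j j', \sum_r (p r)%:C * (Num.conj (y r j) * y r j') =
     (lam j *+ (j == j'))%:C) ->
  (forall r, 1 <= \sum_j sqn (y r j)) ->
  \sum_r g (p r) * (\sum_j sqn (y r j)) <= \sum_j g (lam j).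
Proof.
move=> p0 lam0 yo y1.
(* Coordinates of [sqrt(p_r) T^(-1/2) z_r]. As the inverse of 0 is 0, columns with [lam j = 0]
   vanish and the others are orthonormal. *)
pose x r j := (Num.sqrt (p r) / Num.sqrt (lam j))%:C * y r j.
have sx r j : sqn (x r j) = p r * sqn (y r j) / lam j.
  by rewrite sqnM sqn_realc expr_div_n !sqr_sqrtr// mulrAC.
have lamE j : \sum_r p r * sqn (y r j) = lam j.
  apply: complexI; rewrite sum_complex.
  under eq_bigr do rewrite realcM sqnE.
  by rewrite yo eqxx.
have bx r : \sum_j sqn (x r j) <= 1.
  apply: (@bessel _ _ _ _ (fun j => lam j != 0)) => j j'.
  transitivity ((Num.sqrt (lam j) * Num.sqrt (lam j'))^-1%:C *
     \sum_r (p r)%:C * (Num.conj (y r j) * y r j')).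
    rewrite mulr_sumr; apply: eq_bigr => s _.
    rewrite /x conj_mul conj_realc mulrACA [RHS]mulrA -!realcM; congr (_%:C * _).
    by rewrite invfM -[in RHS](sqr_sqrtr (p0 s)); ring.
  rewrite yo -realcM; have [<-|] := eqVneq j j'; last by rewrite mulr0n mulr0.
  rewrite -expr2 sqr_sqrtr// mulr1n /=; case: eqVneq => [->|l0]/=.
    by rewrite mulr0.
  by rewrite mulVf.
have pE r : p r * (\sum_j sqn (y r j)) = \sum_j sqn (x r j) * lam j.
  rewrite mulr_sumr; apply: eq_bigr => j _; rewrite sx.
  have [l0|l0] := eqVneq (lam j) 0; last by rewrite mulfVK.
  rewrite l0 mulr0.
  have : \sum_r p r * sqn (y r j) = 0 by rewrite lamE.
  by move/eqP; rewrite psumr_eq0 => [/allP/(_ r)|s _];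
    [rewrite mem_index_enum => /(_ isT)/eqP | rewrite mulr_ge0// sqn_ge0].
(* The row sums of [sqn (x r j)] are at most 1, which allows Jensen for each [r]; the column sums
   are 1 wherever [lam j] is nonzero. *)
apply: (@le_trans _ _ (\sum_r \sum_j sqn (x r j) * g (lam j))).
  apply: ler_sum => r _; apply: (le_trans (convex_scale_ge (p0 r) (y1 r))).
  rewrite pE; apply: subconvex_jensen => // j; exact: sqn_ge0.
rewrite exchange_big /=; apply: ler_sum => j _; rewrite -mulr_suml.
have [->|l0] := eqVneq (lam j) 0; first by rewrite g0 mulr0.
rewrite (_ : \sum_r _ = 1) ?mul1r//.
by under eq_bigr do rewrite sx; rewrite -mulr_suml lamE mulfV.
Qed.

End TraceInequality.

Section ConcavePrefix.
Variables (R : realType) (f : R -> R).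
Hypothesis f_ge0 : forall t, 0 <= t -> 0 <= f t.
Hypothesis f_cvx : convex_on (fun t => 0 <= t) (fun t => - f t).

(* With [g t = max 0 (b t + f 0 - f t)], the bound [f t >= f 0 + b t - g t] is
   attained at the first [k] values of [lam], and [g] vanishes at the others. *)
Lemma concave_threshold n (lam : 'I_n -> R) k :
  (forall j, 0 <= lam j) ->
  (forall i j : 'I_n, (i <= j)%N -> lam j <= lam i) ->
  exists b, forall j : 'I_n,
    if (j < k)%N then f (lam j) - f 0 <= b * lam j
    else b * lam j <= f (lam j) - f 0.
Proof.
move=> lam0 lamS.
case: k => [|k].
  exists 0 => j; rewrite mul0r subr_ge0.
  exact: nonneg_concave_mono.
have [kn|nk] := ltnP k n; last first.
  (* All indices lie below the threshold, and the sum of the nonnegative slopes dominates each of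
     them. *)
  exists (\sum_j (f (lam j) - f 0) / lam j) => j.
  rewrite ltnS (leq_trans (ltnW (ltn_ord j)) nk).
  have /predU1P[<-|l0] : (0 == lam j) || (0 < lam j) by rewrite -le_eqVlt.
    by rewrite subrr mulr0.
  rewrite -ler_pdivrMr// (bigD1 j)//= lerDl; apply: sumr_ge0 => i _.
  by rewrite divr_ge0// subr_ge0 nonneg_concave_mono.
pose kk := Ordinal kn.
have : 0 <= lam kk by [].
rewrite le_eqVlt => /predU1P[l0|l0].
  (* All values from index [k] on vanish, so only a large enough [b] is required. *)
  exists (\sum_j (f (lam j) - f 0) / lam j) => j.
  case: ifP => jk.
    have /predU1P[<-|lj] : (0 == lam j) || (0 < lam j) by rewrite -le_eqVlt.
      by rewrite subrr mulr0.
    rewrite -ler_pdivrMr// (bigD1 j)//= lerDl; apply: sumr_ge0 => i _.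
    by rewrite divr_ge0// subr_ge0 nonneg_concave_mono.
  have -> : lam j = 0.
    apply/eqP; rewrite eq_le lam0 andbT l0 lamS//=.
    by move/negbT: jk; rewrite -leqNgt => /ltnW.
  by rewrite mulr0 subrr.
(* The chord slope at the last value of the prefix separates the slopes at larger values from those
   at smaller ones. *)
exists ((f (lam kk) - f 0) / lam kk) => j; rewrite mulrAC.
case: ifP => jk.
  by rewrite ler_pdivlMr//; apply: concave_slope => //; apply: lamS.
rewrite ler_pdivrMr//.
have /predU1P[<-|lj] : (0 == lam j) || (0 < lam j) by rewrite -le_eqVlt.
  by rewrite subrr mul0r mulr0.
apply: concave_slope => //; apply: lamS => /=.
by move/negbT: jk; rewrite -leqNgt => /ltnW.
Qed.

(** The bound [f t >= f 0 + b t - g t] at [t = p r] is summed against [sqn (y r j)] over the first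
    [k] columns. The linear part returns [lam j], and the trace inequality controls the part in
    [g]. *)
Lemma concave_prefix_le (I : finType) n (y : I -> 'I_n -> R[i]) (p : I -> R)
    (lam : 'I_n -> R) k :
  (forall r, 0 <= p r) -> (forall j, 0 <= lam j) ->
  (forall i j : 'I_n, (i <= j)%N -> lam j <= lam i) ->
  (forall j j', \sum_r (p r)%:C * (Num.conj (y r j) * y r j') =
     (lam j *+ (j == j'))%:C) ->
  (forall r, 1 <= \sum_j sqn (y r j)) ->
  (forall j, 1 <= \sum_r sqn (y r j)) ->
  \sum_(j < n | (j < k)%N) f (lam j) <=
    \sum_(j < n | (j < k)%N) \sum_r f (p r) * sqn (y r j).
Proof.
move=> p0 lam0 lamS yo y1 y1'.
have [b bP] := concave_threshold k lam0 lamS.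
pose g t := Num.max 0 (b * t + f 0 - f t).
have g_ge0 t : 0 <= g t by rewrite /g le_max lexx.
have g_ge t : b * t + f 0 - f t <= g t by rewrite /g le_max lexx orbT.
have g0 : g 0 = 0 by rewrite /g mulr0 add0r subrr maxxx.
have g_cvx : convex_on (fun t => 0 <= t) g.
  move=> u a v u0 v0 ua av.
  have au0 : 0 <= a - u by lra.
  have va0 : 0 <= v - a by lra.
  rewrite {1}/g; case: (leP 0 (b * a + f 0 - f a)) => h.
    have := ler_wpM2r va0 (g_ge u).
    have := ler_wpM2r au0 (g_ge v).
    have := f_cvx u0 v0 ua av.
    nra.
  by rewrite mul0r addr_ge0// mulr_ge0.
have tr := trace_convex_ge g_cvx g0 (fun t _ => g_ge0 t) p0 lam0 yo y1.
have lamE j : \sum_r p r * sqn (y r j) = lam j.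
  apply: complexI; rewrite sum_complex.
  under eq_bigr do rewrite realcM sqnE.
  by rewrite yo eqxx.
have fE (j : 'I_n) : (j < k)%N -> f (lam j) = f 0 + b * lam j - g (lam j).
  move=> jk; have := bP j; rewrite jk => h.
  by rewrite /g max_r; lra.
have gE (j : 'I_n) : ~~ (j < k)%N -> g (lam j) = 0.
  move=> jk; have := bP j; rewrite (negbTE jk) => h.
  by rewrite /g max_l; lra.
rewrite (eq_bigr (fun j => f 0 + b * lam j - g (lam j))) //.
rewrite big_split /= sumrN.
(* Since [g] vanishes at the later values, the prefix sum is the full trace of [g(T)]. *)
have -> : \sum_(j < n | (j < k)%N) g (lam j) = \sum_j g (lam j).
  rewrite [RHS](bigID (fun j : 'I_n => (j < k)%N)) /=.
  by rewrite [X in _ + X]big1 ?addr0// => j /gE.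
apply: (@le_trans _ _ (\sum_(j < n | (j < k)%N) (f 0 + b * lam j) -
    \sum_(j < n | (j < k)%N) \sum_r g (p r) * sqn (y r j))).
  rewrite lerD2l lerN2; apply: le_trans tr.
  rewrite exchange_big /=; apply: ler_sum => r _.
  rewrite -mulr_sumr ler_wpM2l//.
  rewrite [X in _ <= X](bigID (fun j : 'I_n => (j < k)%N)) /= lerDl.
  by apply: sumr_ge0 => j _; apply: sqn_ge0.
rewrite -sumrN -big_split /=; apply: ler_sum => j jk.
(* Here [f 0 >= 0] and the column sums are at least 1. *)
apply: (@le_trans _ _ (f 0 * \sum_r sqn (y r j) + b * lam j
    - \sum_r g (p r) * sqn (y r j))).
  rewrite lerD2r lerD2r ler_peMr//; exact: f_ge0.
rewrite -lamE !mulr_sumr -sumrN -!big_split /=; apply: ler_sum => r _.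
by have := ler_wpM2r (sqn_ge0 (y r j)) (g_ge (p r)); lra.
Qed.

End ConcavePrefix.

(** * Weak majorization *)

Section PrefixSums.
Variables (R : realType) (n : nat).
Implicit Types (c d x y : 'I_n -> R).

Lemma prefix_recr d k (kn : (k < n)%N) :
  \sum_(j < n | (j < k.+1)%N) d j = \sum_(j < n | (j < k)%N) d j + d (Ordinal kn).
Proof.
rewrite (bigD1 (Ordinal kn)) //= addrC; congr (_ + _); apply: eq_bigl => j.
by rewrite -val_eqE /= ltnS ltn_neqAle andbC.
Qed.

Lemma prefix_full d k : (n <= k)%N ->
  \sum_(j < n | (j < k)%N) d j = \sum_(j < n | (j < n)%N) d j.
Proof.
by move=> nk; apply: eq_bigl => j; rewrite ltn_ord (leq_trans (ltn_ord j) nk).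
Qed.

(** Summation by parts. The induction carries a stronger bound: the weighted sum is at least its
    last coefficient times the prefix sum of [d]. *)
Lemma abel_sum_ge0 c d k :
  (forall j, 0 <= c j) -> (forall i j : 'I_n, (i <= j)%N -> c j <= c i) ->
  (forall l, (l <= k)%N -> 0 <= \sum_(j < n | (j < l)%N) d j) ->
  0 <= \sum_(j < n | (j < k)%N) c j * d j.
Proof.
move=> c0 cS.
have abel l (ln : (l < n)%N) :
    (forall m, (m <= l.+1)%N -> 0 <= \sum_(j < n | (j < m)%N) d j) ->
    c (Ordinal ln) * \sum_(j < n | (j < l.+1)%N) d j <=
    \sum_(j < n | (j < l.+1)%N) c j * d j.
  elim: l ln => [|l IH] ln d0.
    by rewrite !prefix_recr !big1 ?add0r.
  have ln' := ltnW ln.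
  rewrite [in leLHS]prefix_recr [in leRHS]prefix_recr mulrDr lerD2r.
  apply: le_trans (IH ln' _); last by move=> m ml; apply: d0; exact: leqW.
  by apply: ler_wpM2r; [apply: d0; exact: leqnSn | apply: cS => /=].
have main k' : (k' <= n)%N ->
    (forall l, (l <= k')%N -> 0 <= \sum_(j < n | (j < l)%N) d j) ->
    0 <= \sum_(j < n | (j < k')%N) c j * d j.
  case: k' => [|l] ln d0; first by rewrite big1.
  by apply: le_trans (abel l ln d0); rewrite mulr_ge0// d0.
move=> d0; have [kn|nk] := leqP k n; first exact: main.
rewrite prefix_full ?(ltnW nk)//; apply: main => // l ln.
by apply: d0; exact: leq_trans ln (ltnW nk).
Qed.

(** The subgradient slopes of [F] at the [x j] are nonnegative by monotonicity and decreasing in [j]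
    by convexity, so they serve as weights in a summation by parts. *)
Lemma convex_prefix_le (F : R -> R) x y k :
  convex_on (fun=> True) F -> {homo F : a b / a <= b} ->
  (forall i j : 'I_n, (i <= j)%N -> (j < k)%N -> x j <= x i) ->
  (forall l, (l <= k)%N ->
    \sum_(j < n | (j < l)%N) x j <= \sum_(j < n | (j < l)%N) y j) ->
  \sum_(j < n | (j < k)%N) F (x j) <= \sum_(j < n | (j < k)%N) F (y j).
Proof.
move=> Fcvx Fmono xS xy.
have /choice[sl slP] : forall a, exists sl, forall t, F a + sl * (t - a) <= F t.
  move=> a; have [] := @convex_on_subgradient _ _ _ a (a - 1) (a + 1) Fcvx I _ I.
  - by lra.
  - by lra.
  - by move=> sl slP; exists sl => t; apply: slP.
have sl0 a : 0 <= sl a.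
  by have := slP a (a - 1); have : F (a - 1) <= F a; [apply: Fmono; lra | nra].
have slS a b : a <= b -> sl a <= sl b.
  rewrite le_eqVlt => /predU1P[->//|ab].
  have := slP a b; have := slP b a; have : 0 < b - a by lra.
  nra.
(* The weights are cut off at [k] because [x] is only known to be sorted below [k]. *)
pose cc (j : 'I_n) := if (j < k)%N then sl (x j) else 0.
have cc0 j : 0 <= cc j by rewrite /cc; case: ifP.
have ccS (i j : 'I_n) : (i <= j)%N -> cc j <= cc i.
  rewrite /cc => ij; case: (ltnP j k) => jk.
    by rewrite (leq_ltn_trans ij jk) slS// xS.
  by case: ifP.
have dP l : (l <= k)%N -> 0 <= \sum_(j < n | (j < l)%N) (y j - x j).
  by move=> lk; rewrite sumrB subr_ge0 xy.
have := abel_sum_ge0 cc0 ccS dP.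
move=> h; rewrite -subr_ge0 -sumrB; apply: le_trans h _.
apply: ler_sum => j jk; rewrite /cc jk.
have := slP (x j) (y j); lra.
Qed.

Lemma ln_prod_gt0 (P : pred 'I_n) x : (forall j, P j -> 0 < x j) ->
  ln (\prod_(j < n | P j) x j) = \sum_(j < n | P j) ln (x j).
Proof.
move=> x0; suff [] : 0 < \prod_(j < n | P j) x j /\
  ln (\prod_(j < n | P j) x j) = \sum_(j < n | P j) ln (x j) by [].
apply: (big_rec2 (fun a b => 0 < a /\ ln a = b)); first by rewrite ln1.
by move=> j a b Pj [b0 <-]; rewrite lnM ?posrE ?x0// mulr_gt0 ?x0.
Qed.

(** Logarithms turn the product inequalities into sum inequalities for the convex monotone function
    [f \o expR]. Zero values of [s] have no logarithm to use and are split off. *)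
Lemma e_convex_prefix_le (f : R -> R) (s lam : 'I_n -> R) k :
  convex_on (fun=> True) (f \o expR) ->
  (forall a b, 0 <= a -> a <= b -> f a <= f b) ->
  (forall j, 0 <= s j) -> (forall j, 0 <= lam j) ->
  (forall i j : 'I_n, (i <= j)%N -> s j <= s i) ->
  (forall l, (l <= n)%N -> (forall j : 'I_n, (j < l)%N -> 0 < s j) ->
    \prod_(j < n | (j < l)%N) s j <= \prod_(j < n | (j < l)%N) lam j) ->
  \sum_(j < n | (j < k)%N) f (s j) <= \sum_(j < n | (j < k)%N) f (lam j).
Proof.
move=> fcvx fmono s0 lam0 sS slam.
have pos l : (l <= n)%N -> (forall j : 'I_n, (j < l)%N -> 0 < s j) ->
    \sum_(j < n | (j < l)%N) f (s j) <= \sum_(j < n | (j < l)%N) f (lam j).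
  move=> lN sp.
  (* A zero [lam j] would annihilate a product that dominates a positive one. *)
  have lamp (j : 'I_n) : (j < l)%N -> 0 < lam j.
    move=> jl; rewrite lt_neqAle lam0 andbT eq_sym; apply/eqP => lj0.
    have := slam l lN sp; rewrite [leRHS](bigD1 j)//= lj0 mul0r.
    by apply/negP; rewrite -ltNge; apply: prodr_gt0 => i il; apply: sp.
  rewrite (eq_bigr (fun j => (f \o expR) (ln (s j)))); last first.
    by move=> j jl; rewrite /= lnK// posrE sp.
  rewrite [leRHS](eq_bigr (fun j => (f \o expR) (ln (lam j)))); last first.
    by move=> j jl; rewrite /= lnK// posrE lamp.
  apply: convex_prefix_le => //.
  - by move=> a b ab; rewrite /=; apply: fmono; rewrite ?expR_ge0// ler_expR.
  - move=> i j ij jl; rewrite ler_ln ?posrE ?sp//; first exact: sS.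
    exact: leq_ltn_trans ij jl.
  move=> m ml.
  have sm (j : 'I_n) : (j < m)%N -> 0 < s j by move=> jm; apply: sp;
    exact: leq_trans jm ml.
  have lm (j : 'I_n) : (j < m)%N -> 0 < lam j by move=> jm; apply: lamp;
    exact: leq_trans jm ml.
  rewrite -!ln_prod_gt0// ler_ln ?posrE ?prodr_gt0//.
  by apply: slam => //; exact: leq_trans ml lN.
wlog kn : k / (k <= n)%N.
  move=> W; have [|/ltnW nk] := leqP k n; first exact: W.
  by rewrite !(prefix_full _ nk) W.
have [/forallP sp|/forallPn[i0]] :=
    boolP [forall j : 'I_n, (j < k)%N ==> (0 < s j)].
  by apply: pos => // j jk; have := sp j; rewrite jk.
rewrite negb_imply => /andP[i0k si0].
(* With [i] the first zero of [s], the positive case covers the indices before [i]; afterwards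
   [s j = 0 <= lam j] and monotonicity suffices. *)
case: (@arg_minnP _ i0 (fun i => ~~ (0 < s i)) (fun i => i : nat) si0) => i si imin.
have ik : (i < k)%N by apply: leq_ltn_trans i0k; apply: imin.
rewrite (bigID (fun j : 'I_n => (j < i)%N)) /=
  [leRHS](bigID (fun j : 'I_n => (j < i)%N)) /=.
have e (F : 'I_n -> R) : \sum_(j < n | (j < k)%N && (j < i)%N) F j =
    \sum_(j < n | (j < i)%N) F j.
  apply: eq_bigl => j; rewrite andb_idl// => ji; exact: ltn_trans ji ik.
rewrite !e; apply: lerD.
  apply: pos; first exact: ltnW.
  move=> j ji; rewrite ltNge; apply/negP => sj.
  by have := imin j; rewrite -leNgt sj => /(_ isT); rewrite leqNgt ji.
apply: ler_sum => j /andP[jk]; rewrite -leqNgt => ij; apply: fmono => //.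
by apply: le_trans (lam0 j); apply: le_trans (sS _ _ ij) _; rewrite leNgt.
Qed.

End PrefixSums.

Section SymmetricGauge.
Variables (R : realType) (n : nat) (Phi : ('I_n -> R) -> R).
Hypothesis Phi_convex : forall t u v, 0 <= t -> t <= 1 ->
  Phi (fun i => (1 - t) * u i + t * v i) <= (1 - t) * Phi u + t * Phi v.
Hypothesis Phi_swap : forall u i j, Phi (fun l => u (tperm i j l)) = Phi u.
Hypothesis Phi_flip : forall u i,
  Phi (fun l => if l == i then - u l else u l) = Phi u.

Lemma sum_delta (P : pred 'I_n) k : \sum_(i | P i) (i == k)%:R = (P k)%:R :> R.
Proof.
rewrite big_mkcond /= (bigD1 k) //= big1 ?addr0 ?eqxx; first by case: (P k).
by move=> i ik; rewrite (negbTE ik); case: (P i).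
Qed.

(* Each step moves [y] towards [x] by averaging it with the image of [y] under a
   transposition or a sign change, and equalizes one more coordinate. *)
Lemma gauge_weak_majorization (x y : 'I_n -> R) :
  (forall j, 0 <= x j) -> (forall i j : 'I_n, (i <= j)%N -> x j <= x i) ->
  (forall j, 0 <= y j) ->
  (forall l, \sum_(j < n | (j < l)%N) x j <= \sum_(j < n | (j < l)%N) y j) ->
  Phi x <= Phi y.
Proof.
move=> x0 xS.
(* Induction on the number of coordinates where [x] and [y] differ. *)
have [c] := ubnP #|[set i | x i != y i]|.
elim: c y => [//|c IH] y; rewrite ltnS => yc y0 xy.
have reduce z t u j : (forall i, 0 <= z i) ->
    (forall l, \sum_(i < n | (i < l)%N) x i <= \sum_(i < n | (i < l)%N) z i) ->
    x j != y j -> x j = z j -> (forall i, x i = y i -> x i = z i) ->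
    0 <= t -> t <= 1 -> Phi u = Phi y ->
    (forall i, z i = (1 - t) * y i + t * u i) -> Phi x <= Phi y.
  move=> z0 xz yj zj yz t0 t1 uy zE.
  apply: (@le_trans _ _ (Phi z)).
    apply: IH => //; apply: leq_trans yc; apply: proper_card.
    apply/properP; split.
      by apply/fintype.subsetP => i; rewrite !inE; apply: contra => /eqP/yz/eqP.
    by exists j; rewrite inE ?yj// -zj eqxx.
  rewrite (_ : z = fun i => (1 - t) * y i + t * u i); last exact: funext.
  apply: le_trans (Phi_convex _ _ t0 t1) _.
  by rewrite uy -mulrDl subrK mul1r.
have [/existsP[k0 yxk0]|nyx] := boolP [exists i, y i < x i]; last first.
  have xley i : x i <= y i.
    by rewrite leNgt; apply: contra nyx => yx; apply/existsP; exists i.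
  have [/existsP[j xyj]|nxy] := boolP [exists i, x i != y i]; last first.
    suff -> : x = y by [].
    apply: funext => i; apply/eqP; apply: contraNT nxy => h.
    by apply/existsP; exists i.
  have xj : x j < y j by rewrite lt_neqAle xyj xley.
  have yj : 0 < y j by apply: le_lt_trans xj.
  (* Averaging with the sign change at [j] with this weight multiplies [y j] by
     [1 - 2t = x j / y j]. *)
  apply: (reduce (fun i => if i == j then x j else y i) ((y j - x j) / (2 * y j))
           (fun i => if i == j then - y i else y i) j) => //.
  - by move=> i; case: ifP.
  - by move=> l; apply: ler_sum => i _; case: eqP => [->|].
  - by rewrite eqxx.
  - by move=> i; case: eqP => [->|].
  - by rewrite divr_ge0 ?subr_ge0 ?xley// mulr_ge0.
  - by rewrite ler_pdivrMr ?mulr_gt0// mul1r; have := x0 j; lra.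
  - move=> i; case: eqP => [->|_]; last ring.
    by field; rewrite gt_eqF.
case: (@arg_minnP _ k0 (fun i => y i < x i) (fun i => i : nat) yxk0) => k yxk kmin.
(* [k] is the first index with [y k < x k]. Without an earlier strict excess of [y], the prefix sum
   through [k] would be too small. *)
have [j0 j0P] : exists j : 'I_n, (j < k)%N && (x j < y j).
  apply: contrapT => H.
  have := xy k.+1; rewrite !(prefix_recr _ (ltn_ord k)) (_ : Ordinal _ = k);
    last exact: val_inj.
  apply/negP; rewrite -ltNge ler_ltD//; apply: ler_sum => j jk.
  by rewrite leNgt; apply/negP => xyj; apply: H; exists j; rewrite jk.
case: (@arg_maxnP _ j0 (fun j => (j < k)%N && (x j < y j)) (fun i => i : nat)
         j0P).
move=> j /andP[jk xyj] jmax.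
have xy_between (i : 'I_n) : (j < i)%N -> (i < k)%N -> y i = x i.
  move=> ji ik; apply/eqP; rewrite eq_le; apply/andP; split; rewrite leNgt;
    apply/negP => h.
    by have := jmax i; rewrite ik h => /(_ isT) /=; rewrite leqNgt ji.
  by have := kmin i h; rewrite leqNgt ik.
have xkj : x k <= x j by apply: xS; exact: ltnW.
have kj : (k == j) = false by apply/negbTE; rewrite -val_eqE /= gtn_eqF.
have jk' : (j == k) = false by rewrite eq_sym.
(* The largest amount that can move from coordinate [j] to [k] without passing [x] at either one. *)
pose d := Num.min (y j - x j) (x k - y k).
have d0 : 0 < d by rewrite lt_min !subr_gt0 xyj yxk.
have dj : d <= y j - x j by rewrite ge_min lexx.
have dk : d <= x k - y k by rewrite ge_min lexx orbT.
pose z i := y i + d * ((i == k)%:R - (i == j)%:R).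
have zk : z k = y k + d by rewrite /z eqxx kj /=; ring.
have zj : z j = y j - d by rewrite /z eqxx jk' /=; ring.
have zi i : i != j -> i != k -> z i = y i.
  by move=> ij ik; rewrite /z (negbTE ij) (negbTE ik) /=; ring.
have z0 i : 0 <= z i.
  have [->|ik] := eqVneq i k; first by rewrite zk addr_ge0 ?y0// ltW.
  have [->|ij] := eqVneq i j; first by rewrite zj; have := x0 j; lra.
  by rewrite zi.
(* Only prefixes containing [j] but not [k] lose [d]. For these, [x] and [y] agree strictly between
   [j] and [k], and [z j] is still at least [x j]. *)
have xz l : \sum_(i < n | (i < l)%N) x i <= \sum_(i < n | (i < l)%N) z i.
  have zE : \sum_(i < n | (i < l)%N) z i = \sum_(i < n | (i < l)%N) y i +
      d * ((k < l)%N%:R - (j < l)%N%:R).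
    by rewrite big_split /= -mulr_sumr sumrB !sum_delta.
  have [lj|jl] := leqP l j.
    rewrite zE (ltnNge k) (leq_trans lj (ltnW jk)) (ltnNge j) lj subrr mulr0 addr0.
    exact: xy.
  have [lk|kl] := leqP l k; last by rewrite zE kl jl subrr mulr0 addr0.
  rewrite (bigID (fun i : 'I_n => (i < j)%N)) /=
    [leRHS](bigID (fun i : 'I_n => (i < j)%N)) /=.
  apply: lerD.
    have e (F : 'I_n -> R) : \sum_(i < n | (i < l)%N && (i < j)%N) F i =
        \sum_(i < n | (i < j)%N) F i.
      by apply: eq_bigl => i; rewrite andb_idl// => ij; exact: ltn_trans ij jl.
    rewrite !e [leRHS](eq_bigr y) ?xy// => i ij.
    by rewrite zi// -val_eqE /= ltn_eqF// (ltn_trans ij jk).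
  apply: ler_sum => i /andP[il];
    rewrite -leqNgt leq_eqVlt => /predU1P[/val_inj<-|ji].
    by rewrite zj; lra.
  have ik : (i < k)%N by apply: leq_trans lk.
  have ij : i != j by rewrite -val_eqE /= gtn_eqF.
  have ik' : i != k by rewrite -val_eqE /= ltn_eqF.
  by rewrite zi// xy_between.
have ykj : 0 < y j - y k by lra.
have side i : x i = y i -> x i = z i.
  move=> xyi; rewrite zi//; apply/eqP => e; move: xyi; rewrite e; lra.
have t0 : 0 <= d / (y j - y k) by rewrite divr_ge0// ltW.
have t1 : d / (y j - y k) <= 1 by rewrite ler_pdivrMr// mul1r; lra.
have zE i : z i = (1 - d / (y j - y k)) * y i + d / (y j - y k) * y (tperm j k i).
  case: tpermP => [->|->|/eqP ij /eqP ik].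
  - by rewrite zj; field; rewrite gt_eqF.
  - by rewrite zk; field; rewrite gt_eqF.
  - by rewrite zi//; ring.
(* The minimum is attained, so the transfer equalizes coordinate [j] or coordinate [k]. *)
have /orP[/eqP dE|/eqP dE] : (d == y j - x j) || (d == x k - y k).
    by rewrite /d; case: leP; rewrite eqxx ?orbT.
  apply: (reduce z _ (fun i => y (tperm j k i)) j _ _ _ _ side t0 t1
            (Phi_swap y j k) zE) => //.
    by rewrite lt_eqF.
  by rewrite zj dE; ring.
apply: (reduce z _ (fun i => y (tperm j k i)) k _ _ _ _ side t0 t1
          (Phi_swap y j k) zE) => //.
  by rewrite gt_eqF.
by rewrite zk dE; ring.
Qed.

End SymmetricGauge.

(** * Spectral decomposition *)

Section Adjoint.
Variable R : realType.

Lemma adj_mulmx m n p (A : 'M[R[i]]_(m, n)) (B : 'M[R[i]]_(n, p)) :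
  (A *m B)^t* = B^t* *m A^t*.
Proof. by rewrite trmx_mul map_mxM. Qed.

Lemma adj_sum m n (I : finType) (F : I -> 'M[R[i]]_(m, n)) :
  (\sum_r F r)^t* = \sum_r (F r)^t*.
Proof. by rewrite linear_sum /= map_mx_sum. Qed.

Lemma mulmx_unitary_adj n (U : 'M[R[i]]_n) : U \is unitarymx -> U *m U^t* = 1%:M.
Proof. by move/unitarymxP. Qed.

Lemma mulmx_adj_unitary n (U : 'M[R[i]]_n) : U \is unitarymx -> U^t* *m U = 1%:M.
Proof. by move/unitarymxP/mulmx1C. Qed.

End Adjoint.

Section Spectral.
Variable R : realType.

Definition rdiag n (a : 'I_n -> R) : 'M[R[i]]_n := diag_mx (\row_i (a i)%:C).

Lemma rdiagE n (a : 'I_n -> R) i j : rdiag a i j = (a i)%:C *+ (i == j).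
Proof. by rewrite !mxE. Qed.

Lemma rdiag_mull n p (a : 'I_n -> R) (M : 'M[R[i]]_(n, p)) i j :
  (rdiag a *m M) i j = (a i)%:C * M i j.
Proof. by rewrite mul_diag_mx !mxE. Qed.

Lemma rdiag_mulr n p (a : 'I_n -> R) (M : 'M[R[i]]_(p, n)) i j :
  (M *m rdiag a) i j = M i j * (a j)%:C.
Proof. by rewrite mul_mx_diag !mxE. Qed.

Lemma rdiag_adj n (a : 'I_n -> R) : (rdiag a)^t* = rdiag a.
Proof.
apply/matrixP => i j; rewrite !mxE eq_sym; have [->|] := eqVneq i j.
  by rewrite !mulr1n conj_realc.
by rewrite !mulr0n rmorph0.
Qed.

Lemma adj_diagE n p (U : 'M[R[i]]_(n, p)) (d : 'rV[R[i]]_n) x y :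
  (U^t* *m diag_mx d *m U) x y = \sum_l d 0 l * (Num.conj (U l x) * U l y).
Proof.
rewrite mxE; apply: eq_bigr => l _.
by rewrite mul_mx_diag !mxE mulrAC mulrC mulrA.
Qed.

Lemma adj_rdiagE n p (U : 'M[R[i]]_(n, p)) (a : 'I_n -> R) x y :
  (U^t* *m rdiag a *m U) x y = \sum_l (a l)%:C * (Num.conj (U l x) * U l y).
Proof. by rewrite adj_diagE; apply: eq_bigr => l _; rewrite mxE. Qed.

Lemma unitary_conj_rdiag n (U : 'M[R[i]]_n) (a : 'I_n -> R) : U \is unitarymx ->
  U *m (U^t* *m rdiag a *m U) *m U^t* = rdiag a.
Proof.
move=> /mulmx_unitary_adj UV.
by rewrite !mulmxA UV mul1mx -mulmxA UV mulmx1.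
Qed.

Lemma normal_spectral n (A : 'M[R[i]]_n) : A \is normalmx ->
  A = (spectralmx A)^t* *m diag_mx (spectral_diag A) *m spectralmx A.
Proof.
by move/orthomx_spectralP; rewrite invmx_unitary// spectral_unitarymx.
Qed.

Lemma hermitianP n (A : 'M[R[i]]_n) : reflect (A = A^t*) (A \is hermsymmx).
Proof.
by rewrite is_hermitianmxE expr0 scale1r; apply: eqP.
Qed.

Lemma hermitian_spectral n (A : 'M[R[i]]_n) : A \is hermsymmx ->
  A = (spectralmx A)^t* *m rdiag (fun i => complex.Re (spectral_diag A 0 i))
    *m spectralmx A.
Proof.
move=> hA; rewrite /rdiag (_ : \row_i _ = spectral_diag A).
  exact/normal_spectral/hermitian_normalmx.
apply/rowP => i; rewrite mxE RRe_real//.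
exact: (mxOverP (hermitian_spectral_diag_real hA)).
Qed.

Lemma rdiag_hermitian n p (U : 'M[R[i]]_(n, p)) (a : 'I_n -> R) :
  U^t* *m rdiag a *m U \is hermsymmx.
Proof. by apply/hermitianP; rewrite !adj_mulmx trmxCK rdiag_adj mulmxA. Qed.

Lemma mxfunE n (g : R -> R) (A : 'M[R[i]]_n) : mxfun g A =
  (spectralmx A)^t* *m rdiag (fun i => g (complex.Re (spectral_diag A 0 i)))
    *m spectralmx A.
Proof.
rewrite /mxfun (_ : map_mx _ _ =
  \row_i (g (complex.Re (spectral_diag A 0 i)))%:C)//.
by apply/rowP => i; rewrite !mxE.
Qed.

(* An intertwiner of two real diagonal matrices also intertwines their images
   under [g]. *)
Lemma rdiag_intertwine n (g : R -> R) (S U : 'M[R[i]]_n) (a b : 'I_n -> R) :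
  S \is unitarymx -> U \is unitarymx ->
  S^t* *m rdiag b *m S = U^t* *m rdiag a *m U ->
  S^t* *m rdiag (g \o b) *m S = U^t* *m rdiag (g \o a) *m U.
Proof.
move=> Su Uu SU; have [W WD] : exists W, W = S *m U^t* by exists (S *m U^t*).
have SE : S = W *m U by rewrite WD -mulmxA mulmx_adj_unitary// mulmx1.
have SW : S^t* *m W = U^t* by rewrite WD mulmxA mulmx_adj_unitary// mul1mx.
have WE : rdiag b *m W = W *m rdiag a.
  rewrite -(unitary_conj_rdiag b Su) SU -mulmxA SW.
  by rewrite WD !mulmxA -(mulmxA _ U) mulmx_unitary_adj// mulmx1.
have gWE : rdiag (g \o b) *m W = W *m rdiag (g \o a).
  apply/matrixP => i j; have /matrixP/(_ i j) := WE.
  (* Entrywise, [(b i - a j) * W i j = 0]: either the entry of [W] vanishes or the two eigenvalues,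
     hence their images, agree. *)
  rewrite !rdiag_mull !rdiag_mulr [in RHS]mulrC => /eqP.
  rewrite -subr_eq0 -mulrBl mulf_eq0 subr_eq0.
  case/orP => [/eqP/complexI e|/eqP ->]; first by rewrite /= e mulrC.
  by rewrite mulr0 mul0r.
by rewrite [X in _ *m X]SE mulmxA -(mulmxA _ (rdiag (g \o b))) gWE mulmxA SW.
Qed.

(** The functional calculus is independent of the diagonalization: the chosen spectral one and the
    given one are intertwined. *)
Lemma mxfun_unitary n (g : R -> R) (U : 'M[R[i]]_n) (a : 'I_n -> R) :
  U \is unitarymx ->
  mxfun g (U^t* *m rdiag a *m U) = U^t* *m rdiag (g \o a) *m U.
Proof.
move=> Uu; rewrite mxfunE.
apply: rdiag_intertwine (spectral_unitarymx _) Uu _.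
exact/esym/hermitian_spectral/rdiag_hermitian.
Qed.

Lemma sort_perm n (a : 'I_n -> R) :
  exists s : 'S_n, forall i j : 'I_n, (i <= j)%N -> a (s j) <= a (s i).
Proof.
pose t := [tuple a i | i < n].
have /tuple_permP[s sE] : perm_eq (sort >=%O t) t by rewrite perm_sort.
exists s => i j ij.
have e k : a (s k) = nth 0 (sort >=%O t) k.
  rewrite sE (nth_map k) ?size_enum_ord// nth_ord_enum tnth_mktuple //.
rewrite !e.
have srt : sorted >=%O (sort >=%O t) by apply: sort_sorted; exact: ge_total.
by apply: (sorted_leq_nth (@ge_trans _ _) (@ge_refl _ _) 0 srt) => //;
  rewrite inE size_sort size_tuple.
Qed.

Lemma hermitian_spectral_sorted n (A : 'M[R[i]]_n) : A \is hermsymmx ->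
  exists U, exists a : 'I_n -> R,
   [/\ U \is unitarymx, A = U^t* *m rdiag a *m U &
     forall i j : 'I_n, (i <= j)%N -> a j <= a i].
Proof.
move=> hA; set S := spectralmx A.
pose b i := complex.Re (spectral_diag A 0 i).
have [s sP] := sort_perm b.
exists (row_perm s S), (b \o s); split => //.
  apply/unitarymxP/matrixP => i j.
  have /unitarymxP/matrixP/(_ (s i) (s j)) := spectral_unitarymx A.
  rewrite !mxE (inj_eq perm_inj) => <-; apply: eq_bigr => k _.
  by rewrite !mxE.
rewrite [LHS](hermitian_spectral hA); apply/matrixP => x y.
rewrite !adj_rdiagE (reindex_inj (@perm_inj _ s)) /=; apply: eq_bigr => l _.
by rewrite !mxE.
Qed.

End Spectral.

(** * Symmetric norms of diagonal matrices *)

Section NormDiag.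
Variables (R : realType) (n : nat) (N : 'M[R[i]]_n -> R).
Hypothesis symN : symmetric_norm N.
Implicit Types (X : 'M[R[i]]_n) (u v x y : 'I_n -> R).

Lemma norm_scale a X : 0 <= a -> N (a%:C *: X) = a * N X.
Proof. by move=> a0; rewrite (snormZ symN) ger0_norm ?ler0c. Qed.

Lemma norm_midpoint t X Y : 0 <= t -> t <= 1 ->
  N ((1 - t)%:C *: X + t%:C *: Y) <= (1 - t) * N X + t * N Y.
Proof.
move=> t0 t1; apply: le_trans (snormD symN _ _) _.
by rewrite !norm_scale ?subr_ge0.
Qed.

Lemma norm_unitary_adj U X : U \is unitarymx -> N (U^t* *m X *m U) = N X.
Proof.
move=> Uu; have Vu : U^t* \is unitarymx by rewrite trmxC_unitary.
exact: (snorm_unitary symN X Vu Uu).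
Qed.

Lemma perm_mx_unitary (s : 'S_n) : (perm_mx s : 'M[R[i]]_n) \is unitarymx.
Proof.
by apply/unitarymxP; rewrite tr_perm_mx map_perm_mx -perm_mxM mulgV perm_mx1.
Qed.

Lemma rdiagM u v : rdiag u *m rdiag v = rdiag (fun i => u i * v i) :> 'M[R[i]]_n.
Proof.
apply/matrixP => a b; rewrite rdiag_mull !rdiagE mulrnAr -realcM.
by case: eqP => [->|].
Qed.

Lemma rdiag1 : rdiag (fun=> 1) = 1%:M :> 'M[R[i]]_n.
Proof. by apply/matrixP => a b; rewrite rdiagE mxE. Qed.

Definition sign_mx (j : 'I_n) : 'M[R[i]]_n :=
  rdiag (fun i => if i == j then -1 else 1).

Lemma sign_mx_unitary j : sign_mx j \is unitarymx.
Proof.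
apply/unitarymxP; rewrite rdiag_adj rdiagM -rdiag1; congr rdiag.
by apply: funext => a; case: ifP => _; rewrite ?mulrNN mulr1.
Qed.

Lemma norm_rdiag_convex t u v : 0 <= t -> t <= 1 ->
  N (rdiag (fun i => (1 - t) * u i + t * v i)) <=
  (1 - t) * N (rdiag u) + t * N (rdiag v).
Proof.
move=> t0 t1; rewrite (_ : rdiag _ = (1 - t)%:C *: rdiag u + t%:C *: rdiag v).
  exact: norm_midpoint.
apply/matrixP => a b;
  rewrite [RHS]mxE [X in _ = X + _]mxE [X in _ = _ + X]mxE !rdiagE.
by rewrite realcD !realcM !mulrnAr -mulrnDl.
Qed.

Lemma norm_rdiag_swap u i j : N (rdiag (fun l => u (tperm i j l))) = N (rdiag u).
Proof.
set s := tperm i j.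
rewrite -[RHS](snorm_unitary symN _ (perm_mx_unitary s) (perm_mx_unitary s^-1%g)).
congr N; rewrite -row_permE -col_permE; apply/matrixP => a b.
by rewrite !mxE (inj_eq perm_inj).
Qed.

Lemma norm_rdiag_flip u i :
  N (rdiag (fun l => if l == i then - u l else u l)) = N (rdiag u).
Proof.
rewrite -[RHS](snorm_unitary symN _ (sign_mx_unitary i) (_ : 1%:M \is unitarymx)).
  rewrite mulmx1; congr N; apply/matrixP => a b.
  rewrite rdiag_mull !rdiagE mulrnAr -realcM; case: ifP => _.
    by rewrite mulN1r.
  by rewrite mul1r.
by apply/unitarymxP; rewrite trmx1 map_mx1 mulmx1.
Qed.

(* Averaging [X] with its conjugate by [sign_mx k] erases the off-diagonal
   entries in row and column [k]. *)
Lemma norm_diag_le X y : (forall j, X j j = (y j)%:C) -> N (rdiag y) <= N X.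
Proof.
move=> Xy.
(* The rows and columns of index below [k] are already cleared off the diagonal: [pinch 0] is [X]
   and [pinch n] its diagonal. *)
pose pinch k : 'M[R[i]]_n := \matrix_(a, b)
  (if (a == b) || ((k <= a)%N && (k <= b)%N) then X a b else 0).
have -> : rdiag y = pinch n.
  apply/matrixP => a b; rewrite rdiagE mxE leqNgt ltn_ord /= orbF.
  by case: eqP => [->|]; rewrite ?Xy// mulr0n.
have : (n <= n)%N by [].
elim: {-2}n => [_|k IH kn].
  by rewrite (_ : pinch 0%N = X)//; apply/matrixP => a b; rewrite mxE orbT.
apply: le_trans (IH (ltnW kn)).
pose j := Ordinal kn; pose P := pinch k.
have -> : pinch k.+1 =
    (1 - 2^-1)%:C *: P + (2^-1)%:C *: (sign_mx j *m P *m sign_mx j).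
  apply/matrixP => a b.
  pose sg (i : 'I_n) : R := if i == j then -1 else 1.
  (* The factor is 0 when exactly one of [a], [b] is [k], and 1 otherwise. *)
  transitivity (((1 + sg a * sg b) / 2)%:C * P a b); last first.
    rewrite [RHS]mxE [X in _ = X + _]mxE [X in _ = _ + X]mxE rdiag_mulr rdiag_mull.
    rewrite mulrAC -realcM mulrA -realcM -mulrDl -realcD; congr (_%:C * _).
    by rewrite -/(sg a) -/(sg b); field.
  rewrite !mxE /sg -!(inj_eq val_inj) /=.
  have [ab|ab] := eqVneq (a : nat) b => /=.
    rewrite ab; case: ifP => _; rewrite ?mulrNN ?mulr1.
      by rewrite divff ?pnatr_eq0// mul1r.
    by rewrite divff ?pnatr_eq0// mul1r.
  rewrite !(leq_eqVlt k) !(eq_sym k).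
  case: (eqVneq (a : nat) k) => [ak|ak] /=;
    case: (eqVneq (b : nat) k) => [bk|bk] /=.
  - by rewrite ak bk eqxx in ab.
  - by rewrite ak ltnn mulr1 subrr mul0r mul0r.
  - by rewrite bk ltnn andbF mul1r subrr mul0r mul0r.
  - by rewrite mulr1 divff ?pnatr_eq0// mul1r.
apply: le_trans (norm_midpoint _ _ _ _) _.
- by rewrite invr_ge0.
- by rewrite invf_le1// ler1n.
rewrite (snorm_unitary symN)  ?sign_mx_unitary// -mulrDl subrK mul1r.
exact: lexx.
Qed.

(** On real diagonals the norm is a symmetric gauge function: convex, and invariant under
    transpositions and sign changes. *)
Lemma norm_rdiag_weak_majorization (x y : 'I_n -> R) :
  (forall j, 0 <= x j) -> (forall i j : 'I_n, (i <= j)%N -> x j <= x i) ->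
  (forall j, 0 <= y j) ->
  (forall l, \sum_(j < n | (j < l)%N) x j <= \sum_(j < n | (j < l)%N) y j) ->
  N (rdiag x) <= N (rdiag y).
Proof.
apply: (@gauge_weak_majorization _ _ (fun u => N (rdiag u))).
- exact: norm_rdiag_convex.
- exact: norm_rdiag_swap.
- exact: norm_rdiag_flip.
Qed.

End NormDiag.

(** * Log-majorization *)

Section LogMajorization.
Variable R : realType.

(* Only [ln t <= t - 1] is used: the weights [sqn (x l j)] form a doubly
   substochastic matrix. *)
Lemma prod_compression_le n k (Y : 'I_n -> 'I_k -> R[i]) (lam : 'I_n -> R)
    (gam : 'I_k -> R) : (k <= n)%N ->
  (forall l, 0 <= lam l) -> (forall i j : 'I_n, (i <= j)%N -> lam j <= lam i) ->
  (forall j j', \sum_l Num.conj (Y l j) * Y l j' = (j == j')%:R) ->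
  (forall j j', \sum_l (lam l)%:C * (Num.conj (Y l j) * Y l j') =
     (gam j *+ (j == j'))%:C) ->
  \prod_j gam j <= \prod_(l < n | (l < k)%N) lam l.
Proof.
move=> kn lam0 lamS Yo Yg.
have prod0 : 0 <= \prod_(l < n | (l < k)%N) lam l by apply: prodr_ge0.
have gE j : \sum_l lam l * sqn (Y l j) = gam j.
  apply: complexI; rewrite sum_complex.
  under eq_bigr do rewrite realcM sqnE.
  by rewrite Yg eqxx.
have Y1 j : \sum_l sqn (Y l j) = 1.
  apply: complexI; rewrite sum_complex.
  under eq_bigr do rewrite sqnE.
  by rewrite Yo eqxx.
have g0 j : 0 <= gam j.
  by rewrite -gE; apply: sumr_ge0 => l _; rewrite mulr_ge0 ?sqn_ge0.
have [/existsP[j /eqP gj]|gn] := boolP [exists j, gam j == 0].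
  by rewrite (bigD1 j)//= gj mul0r.
have gp j : 0 < gam j.
  rewrite lt_neqAle g0 andbT eq_sym; apply: contra gn => gj.
  by apply/existsP; exists j.
case: k => [|k] in Y gam kn prod0 Yo Yg gE Y1 g0 gn gp *.
  by rewrite big_ord0 big1.
(* Columns of [Lam^(1/2) Y Gam^(-1/2)], for the diagonal matrices of [lam] and [gam]; they are
   orthonormal because [Y] diagonalizes the compression. *)
pose x l j := (Num.sqrt (lam l) / Num.sqrt (gam j))%:C * Y l j.
have sx l j : sqn (x l j) = lam l * sqn (Y l j) / gam j.
  by rewrite sqnM sqn_realc expr_div_n !sqr_sqrtr// mulrAC.
pose c l := \sum_j sqn (x l j).
have c0 l : 0 <= c l by apply: sumr_ge0 => j _; apply: sqn_ge0.
have c1 l : c l <= 1.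
  apply: (@bessel _ _ _ _ xpredT) => j j'.
  transitivity ((Num.sqrt (gam j) * Num.sqrt (gam j'))^-1%:C *
     \sum_r (lam r)%:C * (Num.conj (Y r j) * Y r j')).
    rewrite mulr_sumr; apply: eq_bigr => s _.
    rewrite /x conj_mul conj_realc mulrACA [RHS]mulrA -!realcM; congr (_%:C * _).
    by rewrite invfM -[in RHS](sqr_sqrtr (lam0 s)); ring.
  rewrite Yg -realcM andbT; have [<-|] := eqVneq j j'; last by rewrite mulr0n mulr0.
  by rewrite -expr2 sqr_sqrtr// mulr1n /= mulVf// gt_eqF.
have x1 j : \sum_l sqn (x l j) = 1.
  under eq_bigr do rewrite sx.
  by rewrite -mulr_suml gE mulfV// gt_eqF.
have cs : \sum_l c l = k.+1%:R.
  rewrite exchange_big /=; under eq_bigr do rewrite x1.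
  by rewrite sumr_const card_ord.
have cl0 l : lam l = 0 -> c l = 0.
  by move=> ll; rewrite /c big1// => j _; rewrite sx ll !mul0r.
pose kk := Ordinal kn.
(* Otherwise the weights [c l <= 1] would live on the first [k] indices while summing to [k.+1]. *)
have lk : 0 < lam kk.
  rewrite lt_neqAle lam0 andbT eq_sym; apply/eqP => lk0.
  have : \sum_l c l <= \sum_(l < n | (l < k)%N) 1.
    rewrite (bigID (fun l : 'I_n => (l < k)%N)) /= [X in _ + X]big1 ?addr0.
      by apply: ler_sum.
    move=> l; rewrite -leqNgt => kl; apply: cl0; apply/eqP;
      rewrite eq_le lam0 andbT.
    by rewrite -lk0 lamS.
  rewrite cs (big_ord_narrow (ltnW kn)) /= sumr_const card_ord.
  by rewrite ler_nat ltnn.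
have lp (l : 'I_n) : (l < k.+1)%N -> 0 < lam l.
  by move=> lk'; apply: lt_le_trans lk _; apply: lamS; rewrite -ltnS.
(* The inequality [ln t <= t - 1] at [t = gam j / lam l], weighted by [sqn (x l j)], has right-hand
   sides that sum to [1 - 1 = 0]. *)
have lng j : ln (gam j) <= \sum_l sqn (x l j) * ln (lam l).
  have : \sum_l sqn (x l j) * (ln (gam j) - ln (lam l)) <=
      \sum_l (sqn (Y l j) - sqn (x l j)).
    apply: ler_sum => l _; rewrite sx.
    have : 0 <= lam l by [].
    rewrite le_eqVlt => /predU1P[<-|l0].
      by rewrite !mul0r subr0 sqn_ge0.
    have h : ln (gam j) - ln (lam l) <= gam j / lam l - 1.
      have r0 : 0 < gam j / lam l by rewrite divr_gt0.
      rewrite -ln_div ?posrE// -[X in ln X](subrKC 1); apply: le_ln1Dx; lra.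
    apply: le_trans (ler_wpM2l _ h) _.
      by rewrite divr_ge0// mulr_ge0 ?sqn_ge0.
    rewrite le_eqVlt; apply/orP; left; apply/eqP; field.
    by rewrite !gt_eqF.
  rewrite sumrB Y1 x1 subrr.
  under eq_bigr do rewrite mulrBr.
  by rewrite sumrB -mulr_suml x1 mul1r subr_le0.
rewrite -ler_ln ?posrE ?prodr_gt0// !ln_prod_gt0//.
apply: (@le_trans _ _ (\sum_l c l * ln (lam l))).
  rewrite /c; under [leRHS]eq_bigr do rewrite mulr_suml.
  by rewrite exchange_big /=; apply: ler_sum.
(* After subtracting [K], the terms are nonnegative on the first [k.+1] indices and nonpositive
   beyond, so weights in [[0, 1]] give at most the prefix sum. The total weight [k.+1] cancels the
   shift. *)
pose K := ln (lam kk).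
have : \sum_l c l * (ln (lam l) - K) <=
    \sum_(l < n | (l < k.+1)%N) (ln (lam l) - K).
  rewrite (bigID (fun l : 'I_n => (l < k.+1)%N)) /= -[leRHS]addr0; apply: lerD.
    apply: ler_sum => l lk'; rewrite ler_piMl// subr_ge0 ler_ln ?posrE ?lp//.
    by apply: lamS; rewrite -ltnS.
  apply: sumr_le0 => l; rewrite -leqNgt => kl.
  have : 0 <= lam l by [].
  rewrite le_eqVlt => /predU1P[/esym/cl0 ->|l0]; first by rewrite mul0r.
  by rewrite mulr_ge0_le0// subr_le0 ler_ln ?posrE// lamS// ltnW.
under eq_bigr do rewrite mulrBr.
rewrite !sumrB -mulr_suml cs.
rewrite [X in _ <= _ - X](_ : _ = k.+1%:R * K); first by rewrite lerD2r.
by rewrite (big_ord_narrow kn) /= sumr_const card_ord mulr_natl.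
Qed.

(** * Real quadratic forms, determinants and positive block matrices *)

Implicit Types (k m n : nat).

Definition rform m n (x : 'cV[R[i]]_m) (A : 'M[R[i]]_(m, n)) (y : 'cV[R[i]]_n) :
    R :=
  complex.Re ((x^t* *m A *m y) 0 0).

Definition nrm2 n (v : 'cV[R[i]]_n) : R := \sum_i sqn (v i 0).

Lemma nrm2E n (v : 'cV[R[i]]_n) : (v^t* *m v) 0 0 = (nrm2 v)%:C.
Proof.
by rewrite mxE sum_complex; apply: eq_bigr => i _; rewrite sqnE !mxE.
Qed.

Lemma nrm2_ge0 n (v : 'cV[R[i]]_n) : 0 <= nrm2 v.
Proof. by apply: sumr_ge0 => i _; apply: sqn_ge0. Qed.

Lemma rform_gram m n (v : 'cV[R[i]]_n) (A : 'M[R[i]]_(m, n)) :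
  rform v (A^t* *m A) v = nrm2 (A *m v).
Proof. by rewrite /rform (mulmxA (v^t*)) -adj_mulmx -mulmxA nrm2E. Qed.

Lemma rform1 n (v : 'cV[R[i]]_n) : rform v 1%:M v = nrm2 v.
Proof. by rewrite /rform mulmx1 nrm2E. Qed.

Lemma rformM m n p q (x : 'cV[R[i]]_p) (B : 'M[R[i]]_(m, p)) (A : 'M[R[i]]_(m, n))
    (C : 'M[R[i]]_(n, q)) (y : 'cV[R[i]]_q) :
  rform (B *m x) A (C *m y) = rform x (B^t* *m A *m C) y.
Proof. by rewrite /rform adj_mulmx !mulmxA. Qed.

Lemma rform_scalel m n (x : 'cV[R[i]]_m) (A : 'M[R[i]]_(m, n)) (y : 'cV[R[i]]_n)
    (t : R) :
  rform (t%:C *: x) A y = t * rform x A y.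
Proof.
have e : (t%:C *: x)^t* = t%:C *: x^t*.
  by apply/matrixP => i j; rewrite !mxE conj_mul conj_realc.
rewrite /rform e -!scalemxAl mxE.
by case: ((x^t* *m A *m y) 0 0) => a b; rewrite /= mul0r subr0.
Qed.

Lemma rform_scaler m n (x : 'cV[R[i]]_m) (A : 'M[R[i]]_(m, n)) (y : 'cV[R[i]]_n)
    (t : R) :
  rform x A (t%:C *: y) = t * rform x A y.
Proof.
rewrite /rform -!scalemxAr mxE.
by case: ((x^t* *m A *m y) 0 0) => a b; rewrite /= mul0r subr0.
Qed.

Lemma rform_sum m n (I : finType) (x : 'cV[R[i]]_m) (A : I -> 'M[R[i]]_(m, n))
    (y : 'cV[R[i]]_n) :
  rform x (\sum_r A r) y = \sum_r rform x (A r) y.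
Proof. by rewrite /rform mulmx_sumr mulmx_suml summxE raddf_sum. Qed.

Lemma rform_adj m n (x : 'cV[R[i]]_m) (A : 'M[R[i]]_(m, n)) (y : 'cV[R[i]]_n) :
  rform y (A^t*) x = rform x A y.
Proof.
rewrite /rform (_ : y^t* *m A^t* *m x = (x^t* *m A *m y)^t*).
  by rewrite !mxE; case: (\sum_j _).
by rewrite !adj_mulmx trmxCK mulmxA.
Qed.

Lemma rform_delta n (A : 'M[R[i]]_n) j :
  rform (delta_mx j 0) A (delta_mx j 0) = complex.Re (A j j).
Proof.
by rewrite /rform trmx_delta map_delta_mx -rowE -colE !mxE.
Qed.

Lemma rform_eigen n (Q : 'M[R[i]]_n) (a : 'I_n -> R) j : Q \is unitarymx ->
  rform (Q^t* *m delta_mx j 0) (Q^t* *m rdiag a *m Q) (Q^t* *m delta_mx j 0) = a j.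
Proof.
move=> Qu; rewrite rformM trmxCK unitary_conj_rdiag//.
by rewrite rform_delta rdiagE eqxx.
Qed.

Lemma nrm2_unitary n (Q : 'M[R[i]]_n) v : Q \is unitarymx -> nrm2 (Q *m v) = nrm2 v.
Proof.
move=> Qu; apply: complexI; rewrite -!nrm2E adj_mulmx -mulmxA (mulmxA _ Q).
by rewrite mulmx_adj_unitary// mul1mx.
Qed.

Lemma nrm2_delta n j : nrm2 (delta_mx j 0 : 'cV[R[i]]_n) = 1.
Proof.
by apply: complexI; rewrite -nrm2E trmx_delta map_delta_mx mul_delta_mx mxE !eqxx.
Qed.

Lemma sqn_det n (A : 'M[R[i]]_n) : (sqn (\det A))%:C = \det (A^t* *m A).
Proof. by rewrite sqnE det_mulmx det_map_mx det_tr. Qed.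

Lemma sqn_det_unitary n (Q : 'M[R[i]]_n) : Q \is unitarymx -> sqn (\det Q) = 1.
Proof. by move=> Qu; apply: complexI; rewrite sqn_det mulmx_adj_unitary// det1. Qed.

Lemma det_rdiag n (a : 'I_n -> R) : \det (rdiag a) = (\prod_j a j)%:C.
Proof.
rewrite det_diag (rmorph_prod (real_complex R)); apply: eq_bigr => j _.
by rewrite mxE.
Qed.

(** [|det M|^2] is the product of the eigenvalues of [M^* M], all of which lie in [[0, 1]]. *)
Lemma sqn_det_contraction n (M : 'M[R[i]]_n) :
  (forall v, nrm2 (M *m v) <= nrm2 v) -> sqn (\det M) <= 1.
Proof.
move=> Mc; pose G := M^t* *m M.
have hG : G \is hermsymmx by apply/hermitianP; rewrite adj_mulmx trmxCK.
have [Q [a [Qu GE _]]] := hermitian_spectral_sorted hG.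
have aE j : a j = nrm2 (M *m (Q^t* *m delta_mx j (0 : 'I_1))).
  by rewrite -(rform_eigen a j Qu) -GE rform_gram.
have -> : sqn (\det M) = \prod_j a j.
  apply: complexI;
    rewrite sqn_det -/G GE !det_mulmx mulrAC -det_mulmx mulmx_adj_unitary//.
  by rewrite det1 mul1r det_rdiag.
apply: prodr_ile1 => j _; rewrite aE nrm2_ge0 /=.
by apply: le_trans (Mc _) _; rewrite nrm2_unitary ?trmxC_unitary// nrm2_delta.
Qed.

(* [psd_block X H G] says that the block matrix [[H, X], [X^*, G]] is positive
   semidefinite (the sign of the off-diagonal block being immaterial). *)
Definition psd_block n (X H G : 'M[R[i]]_n) := forall x y,
  2 * rform x X y <= rform x H x + rform y G y.

Lemma psd_block_sum n (I : finType) (X H G : I -> 'M[R[i]]_n) :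
  (forall r, psd_block (X r) (H r) (G r)) ->
  psd_block (\sum_r X r) (\sum_r H r) (\sum_r G r).
Proof.
move=> XHG x y; rewrite !rform_sum mulr_sumr -big_split /=.
by apply: ler_sum => r _; apply: XHG.
Qed.

(** Testing on [t] times a unit eigenvector of [H] and on its preimage under [X] gives
    [2 t <= t^2 eta_j + c] for every real [t], which at [t = c + 1] excludes [eta_j <= 0]. *)
Lemma psd_block_eigen_gt0 n (X H G Q : 'M[R[i]]_n) (eta : 'I_n -> R) :
  psd_block X H G -> X \in unitmx -> Q \is unitarymx ->
  H = Q^t* *m rdiag eta *m Q ->
  forall j, 0 < eta j.
Proof.
move=> XHG Xu Qu HE j.
pose al : 'cV[R[i]]_n := Q^t* *m delta_mx j 0.
have alH : rform al H al = eta j by rewrite HE rform_eigen.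
pose c := rform (invmx X *m al) G (invmx X *m al).
have alX : rform al X (invmx X *m al) = 1.
  rewrite /rform -mulmxA mulKVmx// nrm2E /= nrm2_unitary ?trmxC_unitary//.
  exact: nrm2_delta.
have key t : 2 * t <= t * (t * eta j) + c.
  have := XHG (t%:C *: al) (invmx X *m al).
  by rewrite !rform_scalel rform_scaler alX alH mulr1.
have c0 : 0 <= c by have := key 0; rewrite mulr0 mul0r add0r.
rewrite ltNge; apply/negP => ej.
have := key (c + 1).
have : (c + 1) * ((c + 1) * eta j) <= 0.
  by rewrite mulrA mulr_ge0_le0// mulr_ge0// addr_ge0.
clear -c0; clearbody c; lra.
Qed.

Lemma psd_block_adj n (X H G : 'M[R[i]]_n) :
  psd_block X H G -> psd_block (X^t*) G H.
Proof. by move=> XHG x y; rewrite rform_adj addrC. Qed.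

(** Up to unitary factors, [M] is [H^(-1/2) X G^(-1/2)]. Positivity of the block makes it a
    contraction, and determinants are compared. *)
Lemma psd_block_det_le n (X H G QH QG : 'M[R[i]]_n) (eta gam : 'I_n -> R) :
  psd_block X H G -> X \in unitmx -> QH \is unitarymx -> QG \is unitarymx ->
  H = QH^t* *m rdiag eta *m QH -> G = QG^t* *m rdiag gam *m QG ->
  sqn (\det X) <= \prod_j eta j * \prod_j gam j.
Proof.
move=> XHG Xu QHu QGu HE GE.
have eta0 := psd_block_eigen_gt0 XHG Xu QHu HE.
have gam0 : forall j, 0 < gam j.
  apply: psd_block_eigen_gt0 (psd_block_adj XHG) _ QGu GE.
  by rewrite map_unitmx unitmx_tr.
pose rt (a : 'I_n -> R) i := (Num.sqrt (a i))^-1.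
pose P (Q : 'M[R[i]]_n) a := rdiag (rt a) *m Q.
have PE Q (a : 'I_n -> R) : Q \is unitarymx -> (forall j, 0 < a j) ->
    P Q a *m (Q^t* *m rdiag a *m Q) *m (P Q a)^t* = 1%:M.
  move=> Qu a0; rewrite /P adj_mulmx rdiag_adj !mulmxA -(mulmxA _ Q (Q^t*)).
  rewrite mulmx_unitary_adj// mulmx1 -(mulmxA _ Q (Q^t*)).
  rewrite mulmx_unitary_adj// mulmx1 !rdiagM -rdiag1; congr rdiag.
  apply: funext => i; rewrite /rt -[X in _ * X * _](sqr_sqrtr (ltW (a0 i))).
  by field; rewrite gt_eqF// sqrtr_gt0.
have Pdet Q (a : 'I_n -> R) : Q \is unitarymx -> (forall j, 0 < a j) ->
    sqn (\det (P Q a)) = (\prod_j a j)^-1.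
  move=> Qu a0; rewrite det_mulmx sqnM (sqn_det_unitary Qu) mulr1 det_rdiag sqn_realc.
  rewrite -prodrXl -prodfV; apply: eq_bigr => i _.
  by rewrite exprVn sqr_sqrtr// ltW.
pose M := P QH eta *m X *m (P QG gam)^t*.
have Mc v : nrm2 (M *m v) <= nrm2 v.
  (* These test vectors turn the hypothesis into [2 |M v|^2 <= |M v|^2 + |v|^2]. *)
  have := XHG ((P QH eta)^t* *m (M *m v)) ((P QG gam)^t* *m v).
  rewrite !(rformM _ (_^t*)) !trmxCK -/M HE GE (PE _ _ QHu eta0) (PE _ _ QGu gam0).
  have -> : rform (M *m v) M v = nrm2 (M *m v) by rewrite /rform -mulmxA nrm2E.
  by rewrite !rform1; lra.
have := sqn_det_contraction Mc.
rewrite /M 2!det_mulmx 2!sqnM det_map_mx det_tr.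
have -> z : sqn (Num.conj z) = sqn z by case: z => a b; rewrite /sqn /= sqrrN.
rewrite (Pdet _ _ QHu eta0) (Pdet _ _ QGu gam0) mulrAC -invfM.
rewrite -ler_pdivlMl ?invr_gt0 ?mulr_gt0 ?prodr_gt0//.
by rewrite invrK mulr1.
Qed.

(** The block is compressed to the first [l] left and right singular vectors of [S]. The
    off-diagonal block becomes the diagonal of the [s j], so the squared product is bounded by two
    determinants of compressions of [T], each at most the product of the first [l] values of
    [lam]. *)
Lemma prod_singular_le n (S T U V : 'M[R[i]]_n) (lam s : 'I_n -> R) l :
  psd_block S T T -> U \is unitarymx -> T = U^t* *m rdiag lam *m U ->
  (forall j, 0 <= lam j) -> (forall i j : 'I_n, (i <= j)%N -> lam j <= lam i) ->
  V \is unitarymx -> S^t* *m S = V^t* *m rdiag (fun i => s i ^+ 2) *m V ->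
  (l <= n)%N -> (forall j : 'I_n, (j < l)%N -> 0 < s j) ->
  \prod_(j < n | (j < l)%N) s j <= \prod_(j < n | (j < l)%N) lam j.
Proof.
move=> ST Uu TE lam0 lamS Vu SE ln s0.
pose w := widen_ord ln; pose sl j := s (w j).
have sl0 j : 0 < sl j by apply: s0 => /=.
pose Vl : 'M[R[i]]_(n, l) := colsub w (V^t*).
(* Left singular vectors [S v_j / s_j], available because the first [l] singular values are
   positive. *)
pose Wl := S *m Vl *m rdiag (fun j => (sl j)^-1).
have VlE (A : 'M[R[i]]_n) : Vl^t* *m A *m Vl = mxsub w w (V *m A *m V^t*).
  apply/matrixP => i j; rewrite !mxE; apply: eq_bigr => a _; rewrite !mxE.
  by congr (_ * _); apply: eq_bigr => b _; rewrite !mxE conjCK.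
have Vl1 : Vl^t* *m Vl = 1%:M.
  rewrite -[Vl^t*]mulmx1 VlE mulmx1 mulmx_unitary_adj//; apply/matrixP => i j.
  by rewrite !mxE -(inj_eq val_inj).
have VSSV : Vl^t* *m (S^t* *m S) *m Vl = rdiag (fun j => sl j ^+ 2).
  rewrite VlE SE unitary_conj_rdiag//.
  by apply/matrixP => i j; rewrite !mxE -(inj_eq val_inj).
have Wl1 : Wl^t* *m Wl = 1%:M.
  transitivity (rdiag (fun j => (sl j)^-1) *m (Vl^t* *m (S^t* *m S) *m Vl) *m
      rdiag (fun j => (sl j)^-1)).
    by rewrite /Wl !adj_mulmx rdiag_adj !mulmxA.
  rewrite VSSV !rdiagM -rdiag1; congr rdiag; apply: funext => j.
  by field; rewrite gt_eqF.
have WSV : Wl^t* *m S *m Vl = rdiag sl.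
  transitivity (rdiag (fun j => (sl j)^-1) *m (Vl^t* *m (S^t* *m S) *m Vl)).
    by rewrite /Wl !adj_mulmx rdiag_adj !mulmxA.
  rewrite VSSV rdiagM; congr rdiag; apply: funext => j.
  by field; rewrite gt_eqF.
have compr (Y : 'M[R[i]]_(n, l)) : Y^t* *m Y = 1%:M ->
    exists Q, exists gam : 'I_l -> R, [/\ Q \is unitarymx,
      Y^t* *m T *m Y = Q^t* *m rdiag gam *m Q &
      0 <= \prod_j gam j <= \prod_(j < n | (j < l)%N) lam j].
  move=> Y1; pose G := Y^t* *m T *m Y.
  have hG : G \is hermsymmx.
    by apply/hermitianP; rewrite /G TE !adj_mulmx !trmxCK rdiag_adj !mulmxA.
  have [Q [gam [Qu GE _]]] := hermitian_spectral_sorted hG.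
  exists Q, gam; split => //.
  pose Z := U *m Y *m Q^t*.
  have Z1 : Z^t* *m Z = 1%:M.
    rewrite /Z !adj_mulmx trmxCK -!mulmxA (mulmxA (U^t*)) mulmx_adj_unitary// mul1mx.
    by rewrite (mulmxA (Y^t*)) Y1 mul1mx mulmx_unitary_adj.
  have Zg : Z^t* *m rdiag lam *m Z = rdiag gam.
    have -> : Z^t* *m rdiag lam *m Z = Q *m G *m Q^t*.
      by rewrite /G TE /Z !adj_mulmx trmxCK !mulmxA.
    by rewrite GE unitary_conj_rdiag.
  have Zg' j j' : \sum_a (lam a)%:C * (Num.conj (Z a j) * Z a j') =
      (gam j *+ (j == j'))%:C.
    rewrite -adj_rdiagE Zg rdiagE; by case: eqP.
  apply/andP; split.
    apply: prodr_ge0 => j _.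
    have := Zg' j j; rewrite eqxx mulr1n => e; rewrite -ler0c -e.
    apply: sumr_ge0 => a _; rewrite -sqnE -realcM ler0c.
    by rewrite mulr_ge0 ?sqn_ge0.
  apply: (prod_compression_le ln lam0 lamS _ Zg') => j j'.
  have /matrixP/(_ j j') := Z1; rewrite !mxE => <-.
  by apply: eq_bigr => a _; rewrite !mxE.
have [QG [gam [QGu GE /andP[gam0 gamle]]]] := compr Vl Vl1.
have [QH [eta [QHu HE /andP[eta0 etale]]]] := compr Wl Wl1.
have XHG : psd_block (rdiag sl) (Wl^t* *m T *m Wl) (Vl^t* *m T *m Vl).
  by move=> x y; rewrite -WSV -!rformM.
have sp : 0 < \prod_j sl j by apply: prodr_gt0.
have Xu : rdiag sl \in unitmx.
  rewrite unitmxE det_rdiag unitfE; apply/eqP => /complexI/eqP.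
  by rewrite gt_eqF.
have := psd_block_det_le XHG Xu QHu QGu HE GE.
rewrite det_rdiag sqn_realc [X in X <= _ -> _]expr2 => h.
rewrite (big_ord_narrow ln) /= -/w.
have le2 := le_trans h (ler_pM eta0 gam0 etale gamle).
rewrite -[leLHS]/(\prod_j sl j).
have L0 : 0 <= \prod_(j < n | (j < l)%N) lam j by apply: prodr_ge0.
rewrite -ler_sqr ?nnegrE ?(ltW sp)// [leLHS]expr2 [leRHS]expr2.
Qed.

End LogMajorization.

(** * Expansive and normal matrices *)

Section Expansive.
Variable R : realType.

Lemma nrm2_eq0 n (v : 'cV[R[i]]_n) : nrm2 v <= 0 -> v = 0.
Proof.
move=> v0; have /eqP : nrm2 v = 0 by apply/eqP; rewrite eq_le v0 nrm2_ge0.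
rewrite psumr_eq0 => [/allP h|i _]; last exact: sqn_ge0.
apply/colP => i; rewrite mxE; apply/sqn_eq0/eqP.
by apply: h; rewrite mem_index_enum.
Qed.

Lemma nrm2B n (u v : 'cV[R[i]]_n) :
  nrm2 (u - v) = nrm2 u + nrm2 v - 2 * complex.Re ((v^t* *m u) 0 0).
Proof.
rewrite [(v^t* *m u) 0 0]mxE raddf_sum mulr_sumr -sumrN -!big_split /=.
apply: eq_bigr => i _; rewrite !mxE.
by case: (u i 0) => a b; case: (v i 0) => c d; rewrite /sqn /=; ring.
Qed.

Lemma expansive_nrm2 n (Z : 'M[R[i]]_n) v : expansive Z -> nrm2 v <= nrm2 (Z *m v).
Proof.
case=> _ /(_ v); rewrite mulmxBr mulmxBl mulmx1 -!mulmxA (mulmxA (v^t*)) -adj_mulmx.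
by rewrite [X in _ <= X]mxE [X in _ <= _ + X]mxE !nrm2E subr_ge0 lecR.
Qed.

Lemma nrm2_mulmx_unit n (Y : 'M[R[i]]_n) :
  (forall v, nrm2 v <= nrm2 (Y *m v)) -> Y \in unitmx.
Proof.
move=> Ye; rewrite -unitmx_tr -row_free_unit -kermx_eq0.
apply/rowV0P => v /sub_kermxP vY.
apply: trmx_inj; rewrite linear0; apply: nrm2_eq0.
apply: le_trans (Ye _) _;
  rewrite -[Y]trmxK -trmx_mul vY linear0 /nrm2 big1// => i _.
by rewrite mxE /sqn /= expr0n addr0.
Qed.

(** With [u = Y x], expanding [0 <= |Y^* u - x|^2] gives [|Y^* u|^2 >= 2 |u|^2 - |x|^2], and
    [|x| <= |u|]. *)
Lemma nrm2_mulmx_adj n (Y : 'M[R[i]]_n) :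
  (forall v, nrm2 v <= nrm2 (Y *m v)) -> forall u, nrm2 u <= nrm2 (Y^t* *m u).
Proof.
move=> Ye u; have Yu := nrm2_mulmx_unit Ye.
pose x := invmx Y *m u.
have Yx : Y *m x = u by rewrite mulKVmx.
have := nrm2_ge0 (Y^t* *m u - x); have := Ye x.
rewrite nrm2B mulmxA -adj_mulmx Yx nrm2E /=; lra.
Qed.

Lemma col_sum_ge1 n (Y : 'M[R[i]]_n) j :
  (forall v, nrm2 v <= nrm2 (Y *m v)) -> 1 <= \sum_l sqn (Y l j).
Proof.
move=> /(_ (delta_mx j 0)); rewrite nrm2_delta -colE /nrm2.
by under eq_bigr do rewrite mxE.
Qed.

Lemma row_sum_ge1 n (Y : 'M[R[i]]_n) l :
  (forall v, nrm2 v <= nrm2 (Y *m v)) -> 1 <= \sum_j sqn (Y l j).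
Proof.
move=> /nrm2_mulmx_adj Ye; have := col_sum_ge1 l Ye.
rewrite (eq_bigr (fun j => sqn (Y l j)))// => j _; rewrite !mxE.
by case: (Y l j) => a b; rewrite /sqn /= sqrrN.
Qed.

End Expansive.

Section Modulus.
Variable R : realType.

Definition modc (z : R[i]) : R := Num.sqrt (sqn z).

Lemma modc_ge0 z : 0 <= modc z. Proof. exact: sqrtr_ge0. Qed.

Lemma modcM z w : modc (z * w) = modc z * modc w.
Proof. by rewrite /modc sqnM sqrtrM// sqn_ge0. Qed.

Lemma sqr_modc z : modc z ^+ 2 = sqn z.
Proof. by rewrite sqr_sqrtr// sqn_ge0. Qed.

Lemma modc_conj z : modc (Num.conj z) = modc z.
Proof. by case: z => a b; rewrite /modc /sqn /= sqrrN. Qed.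

Lemma Re_le_modc z : complex.Re z <= modc z.
Proof.
apply: le_trans (ler_norm _) _; rewrite -sqrtr_sqr ler_sqrt; last exact: sqn_ge0.
by rewrite lerDl sqr_ge0.
Qed.

Lemma Re_mul3_le (a d b : R[i]) :
  2 * complex.Re (d * (Num.conj a * b)) <= modc d * (sqn a + sqn b).
Proof.
have := Re_le_modc (d * (Num.conj a * b)).
rewrite !modcM modc_conj -!sqr_modc.
have := mulr_ge0 (modc_ge0 d) (sqr_ge0 (modc a - modc b)).
lra.
Qed.

Lemma mxabs_gram n (X U : 'M[R[i]]_n) (b : 'I_n -> R) : U \is unitarymx ->
  X^t* *m X = U^t* *m rdiag b *m U ->
  mxabs X = U^t* *m rdiag (fun i => Num.sqrt (b i)) *m U.
Proof. by move=> Uu XE; rewrite /mxabs XE mxfun_unitary. Qed.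

Lemma mxabs_normal n (A : 'M[R[i]]_n) : A \is normalmx ->
  mxabs A = (spectralmx A)^t* *m rdiag (fun i => modc (spectral_diag A 0 i))
    *m spectralmx A.
Proof.
move=> /normal_spectral AE; apply: mxabs_gram; first exact: spectral_unitarymx.
have Uu := spectral_unitarymx A.
rewrite {1 2}AE !adj_mulmx trmxCK -!mulmxA (mulmxA (spectralmx A)).
rewrite mulmx_unitary_adj// mul1mx.
congr (_ *m _); rewrite !mulmxA; congr (_ *m _); apply/matrixP => i j.
rewrite mul_mx_diag !mxE eq_sym; case: eqP => [->|_].
  by rewrite !mulr1n sqnE.
by rewrite !mulr0n rmorph0 mul0r.
Qed.

(** In the coordinates [W *m x] and [W *m y] the forms are diagonal, and the inequality holds
    coordinate by coordinate. *)
Lemma psd_block_normal n (W : 'M[R[i]]_n) (d : 'rV[R[i]]_n)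
    (P := W^t* *m rdiag (fun l => modc (d 0 l)) *m W) :
  psd_block (W^t* *m diag_mx d *m W) P P.
Proof.
have rE (x y : 'cV[R[i]]_n) (c : 'rV[R[i]]_n) :
    rform x (W^t* *m diag_mx c *m W) y =
    \sum_l complex.Re (c 0 l * (Num.conj ((W *m x) l 0) * (W *m y) l 0)).
  rewrite -rformM /rform mxE raddf_sum; apply: eq_bigr => l _.
  by rewrite mul_mx_diag !mxE mulrAC mulrC mulrA.
move=> x y; rewrite /P /rdiag 3!rE mulr_sumr -big_split /=.
apply: ler_sum => l _; apply: le_trans (Re_mul3_le _ _ _) _.
by rewrite mxE -2!sqnE -2!realcM /= mulrDr.
Qed.

End Modulus.

(** * Sums of congruences and the norm inequality *)

Section CongruenceSums.
Variables (R : realType) (m n : nat).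

(** Pairs [(i, l)] index all rows of all [W i], which gives the single sum of rank-one terms used by
    the trace inequality. *)
Lemma congruence_sumE (W : 'I_m -> 'M[R[i]]_n) (q : 'I_m -> 'I_n -> R) j j' :
  (\sum_i (W i)^t* *m rdiag (q i) *m W i) j j' =
  \sum_(r : 'I_m * 'I_n) (q r.1 r.2)%:C *
    (Num.conj (W r.1 r.2 j) * W r.1 r.2 j').
Proof.
rewrite summxE -(pair_bigA _ (fun i l => (q i l)%:C *
  (Num.conj (W i l j) * W i l j'))) /=.
by apply: eq_bigr => i _; rewrite adj_rdiagE.
Qed.

Lemma congruence_sum_hermitian (W : 'I_m -> 'M[R[i]]_n) (q : 'I_m -> 'I_n -> R) :
  \sum_i (W i)^t* *m rdiag (q i) *m W i \is hermsymmx.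
Proof.
apply/hermitianP; rewrite adj_sum; apply: eq_bigr => i _.
exact/hermitianP/rdiag_hermitian.
Qed.

End CongruenceSums.

Theorem corollary1p4 (R : realType) (m n : nat) (m_gt0 : (0 < m)%N)
  (n_gt0 : (0 < n)%N) (A Z : 'I_m -> 'M[R[i]]_n)
  (normalA : forall i, A i \is normalmx)
  (expansiveZ : forall i, expansive (Z i))
  (f : R -> R) (f_ge0 : forall t, 0 <= t -> 0 <= f t)
  (f_concave : concave_on_nonneg f) (f_e_convex : e_convex f)
  (N : 'M[R[i]]_n -> R) (symN : symmetric_norm N) :
  N (mxfun f (mxabs (\sum_(i < m) (Z i)^t* *m A i *m Z i)))
    <= N (\sum_(i < m) (Z i)^t* *m mxfun f (mxabs (A i)) *m Z i).
Proof.
have f_cvx := concave_on_nonneg_cvx f_concave.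
have f_mono a b : 0 <= a -> a <= b -> f a <= f b.
  exact: nonneg_concave_mono.
pose U i := spectralmx (A i); pose d i := spectral_diag (A i).
have Uu i : U i \is unitarymx by apply: spectral_unitarymx.
pose p i l := modc (d i 0 l).
pose W i := U i *m Z i.
set S := \sum_i (Z i)^t* *m A i *m Z i; set B := (X in _ <= N X).
have BE : B = \sum_i (W i)^t* *m rdiag (f \o p i) *m W i.
  apply: eq_bigr => i _.
  rewrite (mxabs_normal (normalA i)) (mxfun_unitary _ _ (Uu i)).
  by rewrite adj_mulmx !mulmxA.
pose T := \sum_i (W i)^t* *m rdiag (p i) *m W i.
have ST : psd_block S T T.
  have -> : S = \sum_i (W i)^t* *m diag_mx (d i) *m W i.
    apply: eq_bigr => i _; rewrite [X in _ *m X *m _](normal_spectral (normalA i)).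
    by rewrite adj_mulmx !mulmxA.
  by apply: psd_block_sum => i; apply: psd_block_normal.
have [E [lam [Eu TE lamS]]] :=
  hermitian_spectral_sorted (congruence_sum_hermitian W p).
rewrite -/T in TE.
have hSS : S^t* *m S \is hermsymmx by apply/hermitianP; rewrite adj_mulmx trmxCK.
have [V [mu [Vu SE muS]]] := hermitian_spectral_sorted hSS.
have mu0 j : 0 <= mu j.
  by rewrite -(rform_eigen mu j Vu) -SE rform_gram nrm2_ge0.
pose s j := Num.sqrt (mu j).
have s0 j : 0 <= s j by apply: sqrtr_ge0.
have sS (i j : 'I_n) : (i <= j)%N -> s j <= s i.
  by move=> ij; apply: ler_wsqrtr; apply: muS.
(* Unitary invariance reduces the left-hand side to the diagonal matrix of the [f (s j)]. *)
rewrite (mxabs_gram Vu SE) mxfun_unitary// norm_unitary_adj// -/s.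
pose I := ('I_m * 'I_n)%type.
(* Row [l] of [Y i] holds, up to conjugation, the coordinates of [z_r], [r = (i, l)], in the
   eigenbasis of [T]. *)
pose Y i := W i *m E^t*.
pose y (r : I) j := Y r.1 r.2 j; pose q (r : I) := p r.1 r.2.
have diagE (g : 'I_m -> 'I_n -> R) j j' :
    \sum_r (g r.1 r.2)%:C * (Num.conj (y r j) * y r j') =
    (E *m (\sum_i (W i)^t* *m rdiag (g i) *m W i) *m E^t*) j j'.
  rewrite -congruence_sumE mulmx_sumr mulmx_suml; congr ((_ : 'M[R[i]]_n) _ _).
  by apply: eq_bigr => i _; rewrite adj_mulmx trmxCK !mulmxA.
have q0 r : 0 <= q r by apply: modc_ge0.
have yo j j' : \sum_r (q r)%:C * (Num.conj (y r j) * y r j') =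
    (lam j *+ (j == j'))%:C.
  rewrite (diagE p) -/T TE (unitary_conj_rdiag _ Eu).
  by rewrite rdiagE; case: eqP.
have lam0 j : 0 <= lam j.
  have := yo j j; rewrite eqxx mulr1n => e; rewrite -ler0c -e.
  by apply: sumr_ge0 => r _; rewrite -sqnE -realcM ler0c mulr_ge0 ?sqn_ge0.
(* [Y i] is [Z i] between two unitaries, so it is expansive; row and column sums of squared moduli
   are then at least 1. *)
have Ye i v : nrm2 v <= nrm2 (Y i *m v).
  rewrite -!mulmxA (nrm2_unitary _ (Uu i));
    apply: le_trans (expansive_nrm2 _ (expansiveZ i)).
  by rewrite nrm2_unitary ?trmxC_unitary.
have yrow r : 1 <= \sum_j sqn (y r j) by apply: row_sum_ge1.
(* The block of a single index [i] already contributes 1, and one exists because [0 < m]. *)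
have ycol j : 1 <= \sum_r sqn (y r j).
  rewrite -(pair_bigA _ (fun i l => sqn (Y i l j))) /= (bigD1 (Ordinal m_gt0))//=.
  rewrite -[leLHS]addr0 lerD ?col_sum_ge1//.
  by apply: sumr_ge0 => i _; apply: sumr_ge0 => l _; apply: sqn_ge0.
pose b j := \sum_r f (q r) * sqn (y r j).
have bE j : (E *m B *m E^t*) j j = (b j)%:C.
  rewrite BE -(diagE (fun i => f \o p i)) sum_complex; apply: eq_bigr => r _.
  by rewrite realcM sqnE.
have fs_le k : \sum_(j < n | (j < k)%N) f (s j) <= \sum_(j < n | (j < k)%N) b j.
  apply: le_trans (concave_prefix_le f_ge0 f_cvx k q0 lam0 lamS yo yrow ycol).
  apply: e_convex_prefix_le => //; first exact: e_convex_cvx.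
  move=> l ln sp; apply: (prod_singular_le ST Eu TE lam0 lamS Vu _ ln sp).
  rewrite SE (_ : (fun i => s i ^+ 2) = mu)//.
  by apply: funext => j; rewrite sqr_sqrtr.
apply: (@le_trans _ _ (N (rdiag b))).
  apply: norm_rdiag_weak_majorization => //.
  - by move=> j; apply: f_ge0.
  - by move=> i j ij; apply: f_mono => //; apply: sS.
  - by move=> j; apply: sumr_ge0 => r _; rewrite mulr_ge0 ?sqn_ge0 ?f_ge0.
(* [b] is the diagonal of [B] in the eigenbasis of [T], so pinching concludes. *)
rewrite -(snorm_unitary symN B Eu (_ : E^t* \is unitarymx)) ?trmxC_unitary//.
exact: norm_diag_le.
Qed.
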